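(* Let $\Omega\subseteq\mathbb{R}^d$ be a compact convex region, let $V\subset C(\Omega)\subset L_2(\Omega)$, let $\Psi$ be a continuous symmetric positive definite kernel on $\Omega\times\Omega$, and let $f=\{f(g):g\in V\}$ be a mean-zero Gaussian process with covariance function $$K(g,g')=\int_\Omega\int_\Omega g(\mathbf{x})g'(\mathbf{x}')\Psi(\mathbf{x},\mathbf{x}')\,d\mathbf{x}\,d\mathbf{x}'.$$ Let $g_1,\dots,g_n\in V$ and let $\hat f(g)=\mathbb{E}[f(g)\mid f(g_1),\dots,f(g_n)]$. Define the linear operator $\mathcal{T}$ on $L_2(\Omega)$ by $\mathcal{T}g(\mathbf{x})=\int_\Omega g(\mathbf{x}')\Psi(\mathbf{x},\mathbf{x}')\,d\mathbf{x}'$. Then for every $g\in V$, $$\mathbb{E}\left(f(g)-\hat f(g)\right)^2=\min_{(u_1,\dots,u_n)\in\mathbb{R}^n}\left\|\mathcal{T}g-\sum_{j=1}^n u_j\,\mathcal{T}g_j\right\|_{\mathcal{N}_\Psi(\Omega)}^2 .$$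
   Context: $\mathcal{N}_\Psi(\Omega)$ denotes the reproducing kernel Hilbert space (RKHS) of functions on $\Omega$ associated with the kernel $\Psi$, and $\|\cdot\|_{\mathcal{N}_\Psi(\Omega)}$ its norm; it is known that $\mathcal{T}$ maps $L_2(\Omega)$ into $\mathcal{N}_\Psi(\Omega)$. When the matrix $\mathbf{K}_n=(K(g_j,g_k))_{j,k}$ is invertible, the predictor is $\hat f(g)=\mathbf{k}_n(g)^T\mathbf{K}_n^{-1}\mathbf{y}_n$ with $\mathbf{k}_n(g)=(K(g,g_1),\dots,K(g,g_n))^T$ and $\mathbf{y}_n=(f(g_1),\dots,f(g_n))^T$. *)

(* Defs.v *)
From HB Require Import structures.
From mathcomp Require Import all_boot all_order all_algebra.
From mathcomp Require Import all_classical all_reals all_analysis.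
Set Implicit Arguments.
Unset Strict Implicit.
Unset Printing Implicit Defensive.
Import Order.TTheory GRing.Theory Num.Theory.
Import numFieldNormedType.Exports.
Local Open Scope classical_set_scope.
Local Open Scope ring_scope.

Definition rV_display : measure_display.
Proof. exact: default_measure_display. Qed.

(* The sigma-algebra on R^d is the product one, generated by the coordinates;
   it coincides with the Borel sigma-algebra. *)
Section measurable_rV.
Context {R : realType} (d : nat).

Definition rV_coord (i : 'I_d) (v : 'rV[R]_d) : measurableTypeR R := v ord0 i.

Let rV_set0 : g_sigma_preimage rV_coord set0.
Proof. exact: sigma_algebra0. Qed.

Let rV_setC A : g_sigma_preimage rV_coord A -> g_sigma_preimage rV_coord (~` A).
Proof. exact: sigma_algebraC. Qed.

Let rV_bigcup (F : (set 'rV[R]_d)^nat) :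
  (forall i, g_sigma_preimage rV_coord (F i)) ->
  g_sigma_preimage rV_coord (\bigcup_i F i).
Proof. exact: sigma_algebra_bigcup. Qed.

HB.instance Definition _ := @isMeasurable.Build
  rV_display 'rV[R]_d (g_sigma_preimage rV_coord)
  rV_set0 rV_setC rV_bigcup.

End measurable_rV.

Section lebesgue_rV.
Context {R : realType}.
Local Open Scope ereal_scope.

Definition rV_cons d (p : measurableTypeR R * 'rV[R]_d) : 'rV[R]_d.+1 :=
  \row_i (if unlift ord0 i is Some j then p.2 ord0 j else p.1).

Lemma measurable_rV_coord d (i : 'I_d) :
  measurable_fun setT (rV_coord i : 'rV[R]_d -> measurableTypeR R).
Proof.
move=> _ Y mY; rewrite setTI; apply: sub_sigma_algebra => /=.
rewrite -bigcup_seq/=; exists i => /=; first by rewrite mem_index_enum.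
by exists Y => //; rewrite setTI.
Qed.

Lemma measurable_fun_rV dT (T : measurableType dT) d (h : T -> 'rV[R]_d) :
  (forall i, measurable_fun setT (rV_coord i \o h : T -> measurableTypeR R)) ->
  measurable_fun setT h.
Proof.
move=> mh; apply: (@measurability _ _ _ _ _ _
  (\big[setU/set0]_(i < d)
    preimage_set_system setT (@rV_coord R d i) measurable)) => //.
move=> _ [B + <-]; rewrite -bigcup_seq/= => -[i _ [C mC <-]].
by rewrite !setTI -comp_preimage -[X in measurable X]setTI; exact: mh.
Qed.

Lemma rV_cons0 d (p : measurableTypeR R * 'rV[R]_d) :
  rV_cons p ord0 ord0 = p.1.
Proof. by rewrite mxE unlift_none. Qed.

Lemma rV_consS d (p : measurableTypeR R * 'rV[R]_d) (i : 'I_d) :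
  rV_cons p ord0 (lift ord0 i) = p.2 ord0 i.
Proof. by rewrite mxE liftK. Qed.

Lemma measurable_rV_cons d : measurable_fun setT (@rV_cons d).
Proof.
apply: measurable_fun_rV => i; have [j ->|->] := unliftP ord0 i.
  rewrite (_ : _ \o _ = rV_coord j \o snd).
    exact: (measurableT_comp (measurable_rV_coord j) measurable_snd).
  by apply/funext => p /=; rewrite /rV_coord rV_consS.
rewrite (_ : _ \o _ = fst); first exact: measurable_fst.
by apply/funext => p /=; rewrite /rV_coord rV_cons0.
Qed.

Section step.
Context d (m : {sigma_finite_measure set 'rV[R]_d -> \bar R}).

Definition lebesgue_rV_step : set 'rV[R]_d.+1 -> \bar R :=
  pushforward (@lebesgue_measure R \x m) (@rV_cons d).

Let step0 : lebesgue_rV_step set0 = 0.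
Proof. by rewrite /lebesgue_rV_step /pushforward preimage_set0 measure0. Qed.

Let step_ge0 A : 0 <= lebesgue_rV_step A.
Proof. exact: (measure_ge0 (lebesgue_measure \x m)). Qed.

Let step_sigma_additive : semi_sigma_additive lebesgue_rV_step.
Proof.
move=> F mF tF mUF; rewrite /lebesgue_rV_step /pushforward preimage_bigcup.
have mpre A : measurable A -> measurable (@rV_cons d @^-1` A).
  by move=> mA; rewrite -[X in measurable X]setTI; exact: measurable_rV_cons.
apply: measure_semi_sigma_additive => [n||]; first exact: mpre.
- apply/trivIsetP => i j _ _ ij; rewrite -preimage_setI.
  by move/trivIsetP : tF => /(_ _ _ _ _ ij) ->//; rewrite preimage_set0.
- by rewrite -preimage_bigcup; exact: mpre.
Qed.

HB.instance Definition _ := isMeasure.Build _ _ _ lebesgue_rV_step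
  step0 step_ge0 step_sigma_additive.

Definition rV_uncons (v : 'rV[R]_d.+1) : measurableTypeR R * 'rV[R]_d :=
  (v ord0 ord0, \row_i v ord0 (lift ord0 i)).

Lemma rV_consK : cancel (@rV_cons d) rV_uncons.
Proof.
move=> p; rewrite /rV_uncons rV_cons0 [RHS]surjective_pairing; congr pair.
by apply/rowP => i; rewrite mxE rV_consS.
Qed.

Lemma rV_unconsK : cancel rV_uncons (@rV_cons d).
Proof.
move=> v; apply/rowP => i; have [j ->|->] := unliftP ord0 i.
  by rewrite rV_consS mxE.
by rewrite rV_cons0.
Qed.

Lemma measurable_rV_uncons : measurable_fun setT rV_uncons.
Proof.
apply/measurable_fun_pairP; split => /=.
  exact: (measurable_rV_coord (ord0 : 'I_d.+1)).
apply: measurable_fun_rV => i.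
rewrite (_ : _ \o _ = rV_coord (lift ord0 i)); first exact: measurable_rV_coord.
by apply/funext => v /=; rewrite /rV_coord mxE.
Qed.

Let step_sigma_finite : sigma_finite setT lebesgue_rV_step.
Proof.
have /sigma_finiteP[F [TF ndF Foo]] := sigma_finiteT (@lebesgue_measure R).
have /sigma_finiteP[G [TG ndG Goo]] := sigma_finiteT m.
exists (fun n => rV_uncons @^-1` (F n `*` G n)) => [|n].
  rewrite -preimage_bigcup (_ : \bigcup_n _ = setT) ?preimage_setT//.
  apply/seteqP; split=> // -[x y] _.
  have [i _ Fx] : (\bigcup_n F n) x by rewrite -TF.
  have [j _ Gy] : (\bigcup_n G n) y by rewrite -TG.
  exists (maxn i j) => //; split => /=.
    by move: x Fx; exact/subsetPset/ndF/leq_maxl.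
  by move: y Gy; exact/subsetPset/ndG/leq_maxr.
have [mF Fn] := Foo n; have [mG Gn] := Goo n; split.
  rewrite -[X in measurable X]setTI; apply: measurable_rV_uncons => //.
  exact: measurableX.
rewrite /lebesgue_rV_step /pushforward -comp_preimage.
rewrite [X in X @^-1` _](_ : _ = id); last by apply/funext => p /=; rewrite rV_consK.
by rewrite preimage_id product_measure1E// lte_mul_pinfty// ge0_fin_numE.
Qed.

HB.instance Definition _ := Measure_isSigmaFinite.Build _ _ _ lebesgue_rV_step
  step_sigma_finite.

End step.

(* Lebesgue measure on R^d, as the d-fold product of the one on R;
   see lebesgue_rV_box for its values on boxes. *)
Fixpoint lebesgue_rV (d : nat) : {sigma_finite_measure set 'rV[R]_d -> \bar R} :=
  match d with
  | 0 => \d_(0%R : 'rV[R]_0)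
  | d'.+1 => lebesgue_rV_step (lebesgue_rV d')
  end.

Lemma lebesgue_rV_box d (a b : 'I_d -> R) : (forall i, (a i <= b i)%R) ->
  lebesgue_rV d [set v : 'rV[R]_d | forall i, (a i <= v ord0 i <= b i)%R] =
  (\prod_(i < d) (b i - a i))%R%:E.
Proof.
elim: d a b => [|d IH] a b ab.
  rewrite big_ord0 /= diracE mem_set//; by case.
transitivity ((@lebesgue_measure R \x lebesgue_rV d)
  ([set` `[a ord0, b ord0]] `*`
   [set v : 'rV[R]_d | forall i, (a (lift ord0 i) <= v ord0 i <= b (lift ord0 i))%R])).
  congr ((_ \x _) _); apply/seteqP; split => -[x v] /=.
    move=> h; split => [|i]; last by have := h (lift ord0 i); rewrite rV_consS.
    by have := h ord0; rewrite rV_cons0 in_itv.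
  move=> [/= hx hv] i; have [j ->|->] := unliftP ord0 i.
    by rewrite rV_consS.
  by rewrite rV_cons0; move: hx; rewrite in_itv.
rewrite product_measure1E//; last first.
  rewrite (_ : [set _ | _] = \bigcap_(i in [set: 'I_d])
    (rV_coord i @^-1` [set` `[a (lift ord0 i), b (lift ord0 i)]])).
    apply: fin_bigcap_measurable => // i _; rewrite -[X in measurable X]setTI.
    exact: measurable_rV_coord.
  apply/seteqP; split=> v /= h i.
    by move=> _; rewrite /rV_coord /= in_itv; exact: h.
  by move: (h i I); rewrite /rV_coord /= in_itv.
rewrite IH// big_ord_recl EFinM; congr (_ * _).
transitivity (lebesgue_measure (`[a ord0, b ord0]%classic : set R)) => //.
rewrite lebesgue_measure_itv/= lte_fin.
by case: ltgtP (ab ord0) => // -> _; rewrite subrr.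
Qed.

End lebesgue_rV.

Section kernels.
Context {R : realType} (X : Type).
Implicit Types (A : set X) (k : X -> X -> R).

Definition symmetric_on A k := forall x y, A x -> A y -> k x y = k y x.

(* Positive definite in the sense of Aronszajn: the Gram matrices are positive
   semidefinite, not necessarily invertible. *)
Definition posdef_on A k := forall (m : nat) (x : 'I_m -> X) (c : 'I_m -> R),
  (forall i, A (x i)) ->
  0 <= \sum_(i < m) \sum_(j < m) c i * c j * k (x i) (x j).

Definition dot_norm (dot : (X -> R) -> (X -> R) -> R) (h : X -> R) : R :=
  Num.sqrt (dot h h).

(* The reproducing kernel Hilbert space of k; it is determined by k. The values
   of rkhs_dot on functions outside rkhs_set are irrelevant. *)
Record rkhs k := Rkhs {
  rkhs_set : set (X -> R) ;
  rkhs_dot : (X -> R) -> (X -> R) -> R ;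
  rkhs_set0 : rkhs_set 0 ;
  rkhs_setZD : forall (a : R) h1 h2, rkhs_set h1 -> rkhs_set h2 ->
    rkhs_set (a *: h1 + h2) ;
  rkhs_dotC : forall h1 h2, rkhs_set h1 -> rkhs_set h2 ->
    rkhs_dot h1 h2 = rkhs_dot h2 h1 ;
  rkhs_dotZD : forall (a : R) h1 h2 h3,
    rkhs_set h1 -> rkhs_set h2 -> rkhs_set h3 ->
    rkhs_dot (a *: h1 + h2) h3 = a * rkhs_dot h1 h3 + rkhs_dot h2 h3 ;
  rkhs_dot_gt0 : forall h, rkhs_set h -> h <> 0 -> 0 < rkhs_dot h h ;
  rkhs_complete : forall u : nat -> X -> R, (forall n, rkhs_set (u n)) ->
    (forall e : R, 0 < e -> exists N, forall m n, (N <= m)%N -> (N <= n)%N ->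
      dot_norm rkhs_dot (u m - u n) < e) ->
    exists2 h, rkhs_set h & dot_norm rkhs_dot (u n - h) @[n --> \oo] --> 0 ;
  rkhs_kernel : forall y, rkhs_set (k^~ y) ;
  rkhs_reproducing : forall h y, rkhs_set h -> rkhs_dot h (k^~ y) = h y
}.

Definition rkhs_norm k (H : rkhs k) (h : X -> R) : R := dot_norm (rkhs_dot H) h.

End kernels.

Section integral_operators.
Context {R : realType} (d : nat).
Variables (Omega : set 'rV[R]_d) (Psi : 'rV[R]_d -> 'rV[R]_d -> R).

Definition kernel_on : Omega -> Omega -> R :=
  fun x y => Psi (set_val x) (set_val y).

Definition integral_covariance (g g' : 'rV[R]_d -> R) : R :=
  \int[lebesgue_rV d]_(x in Omega)
    (\int[lebesgue_rV d]_(x' in Omega) (g x * g' x' * Psi x x')).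

(* The values are functions on the subtype Omega, as are the elements of the
   reproducing kernel Hilbert space of [kernel_on]. *)
Definition integral_op (g : 'rV[R]_d -> R) : Omega -> R :=
  fun x => \int[lebesgue_rV d]_(x' in Omega) (g x' * Psi (set_val x) x').

End integral_operators.

Section gaussian_processes.
Context {R : realType} {dT : measure_display} {T : measurableType dT}.
Variable P : probability T R.

(* normal_prob m 0 is not the degenerate law, whence the case distinction. *)
Definition gaussian_law (m s : R) (B : set R) : \bar R :=
  if s == 0 then \d_m B else normal_prob m s B.

Definition gaussian_variable (X : T -> R) := exists m s : R,
  forall B : set R, measurable B -> P (X @^-1` B) = gaussian_law m s B.

Definition gaussian_process (I : Type) (f : I -> {RV P >-> R}) :=
  forall (m : nat) (i : 'I_m -> I) (c : 'I_m -> R),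
  gaussian_variable (fun w => \sum_(k < m) c k * f (i k) w).

Definition centered_with_covariance (I : Type) (f : I -> {RV P >-> R})
    (K : I -> I -> R) :=
  (forall i, 'E_P[f i] = 0)%E /\
  (forall i j, covariance P (f i) (f j) = (K i j)%:E).

(* Z is a version of E[X | Y_0, ..., Y_(n-1)] *)
Definition is_cond_expectation (n : nat) (Y : 'I_n -> T -> R) (X Z : T -> R) :=
  [/\ forall B : set R, measurable B -> g_sigma_preimage Y (Z @^-1` B),
      P.-integrable setT (EFin \o Z) &
      forall A, g_sigma_preimage Y A ->
        (\int[P]_(w in A) (Z w)%:E = \int[P]_(w in A) (X w)%:E)%E].

End gaussian_processes.

Definition is_min {disp : Order.disp_t} {S : porderType disp} (A : set S) (m : S) :=
  A m /\ lbound A m.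

(* Main.v *)
Require Import Defs.
From HB Require Import structures.
From mathcomp Require Import all_boot all_order all_algebra.
From mathcomp Require Import all_classical all_reals all_analysis.
From mathcomp Require Import measurable_realfun ring lra.
Set Implicit Arguments.
Unset Strict Implicit.
Unset Printing Implicit Defensive.
Import Order.TTheory GRing.Theory Num.Theory.
Import numFieldNormedType.Exports.
Local Open Scope classical_set_scope.
Local Open Scope ring_scope.

(* In the reproducing kernel Hilbert space N of Psi, Tg is the norm limit of the
   Riemann sums of the integral of g(x) Psi(., x) dx, whence Tg is in N and
   <Tg, Tg'> = K(g, g'). So the squared norm of Tg - sum_j u_j Tg_j is the
   variance of f(g) - sum_j u_j f(g_j), and it remains to see that the conditional
   expectation of f(g) is its orthogonal projection sum_j u_j f(g_j). Let
   Z = f(g) - sum_j u_j f(g_j) be uncorrelated with Y = (f(g_1), .., f(g_n)). Then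
   s Z + t.Y and - s Z + t.Y are centered Gaussian with the same variance, hence
   have the same law, so that E[sin(s Z) cos(t.Y + b)] = 0, and for s -> 0
   E[Z cos(t.Y + b)] = 0 for all t and b. The bounded functions q such that
   multiplication by q(Y) preserves this orthogonality form an algebra closed under
   bounded pointwise limits; it contains the indicators of half-lines in each
   coordinate, hence those of all events of sigma(Y), and E[Z | Y] = 0. *)

(** * Orthogonality to trigonometric polynomials *)

(** The hypothesis on f concerns one-dimensional laws of linear combinations, whereas conditioning
    is about the joint law of f(g) and Y. The product sin(s Z) cos(t.Y + b) bridges the two: it is
    half the difference of the sines of s Z + t.Y + b and - s Z + t.Y + b, each a function of a
    single linear combination. The passage from cosines to events uses only algebra operations and
    bounded limits, so indicators must be reached through polynomials; this is why the sign function
    is obtained by iterating a cubic. The variables f(g_j) may be linearly dependent, so their Gram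
    matrix can be singular: the u_j come from the consistency of the normal equations and need not
    be unique, while the residual Z is determined almost everywhere. In the Hilbert space, the
    reproducing property turns the inner product of two Riemann sums into a double Riemann sum for
    K(g, g') with independent meshes in the two variables; this makes the sums Cauchy. *)

Section Rintegral_complements.
Context d (T : measurableType d) (R : realType).
Variables (mu : {measure set T -> \bar R}) (D : set T).

Lemma measurable_fun_cvgr (f_ : (T -> R)^nat) (f : T -> R) :
  measurable D -> (forall n, measurable_fun D (f_ n)) ->
  (forall x, D x -> f_ n x @[n --> \oo] --> f x) -> measurable_fun D f.
Proof.
move=> mD mf ff; apply/measurable_EFinP.
apply: (emeasurable_fun_cvg (fun n => EFin \o f_ n)) => //.
- by move=> n; exact/measurable_EFinP.
- by move=> x Dx; apply: cvg_EFin; [exact: nearW|exact: ff].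
Qed.

Lemma Rintegral_dominated_cvg (f_ : (T -> R)^nat) (f g : T -> R) :
  measurable D -> (forall n, measurable_fun D (f_ n)) ->
  (forall x, D x -> f_ n x @[n --> \oo] --> f x) ->
  mu.-integrable D (EFin \o g) ->
  (forall n x, D x -> `|f_ n x| <= g x) ->
  mu.-integrable D (EFin \o f) /\
  \int[mu]_(x in D) f_ n x @[n --> \oo] --> \int[mu]_(x in D) f x.
Proof.
move=> mD mf ff ig fg.
have mf' : measurable_fun D f by exact: measurable_fun_cvgr ff.
have [|||||i1 _ i2] := @dominated_convergence _ _ _ mu D mD
    (fun n => EFin \o f_ n) (EFin \o f) (EFin \o g).
- by move=> n; exact/measurable_EFinP.
- exact/measurable_EFinP.
- by apply: aeW => x Dx; apply: cvg_EFin; [exact: nearW|exact: ff].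
- exact: ig.
- by apply: aeW => x n Dx; rewrite lee_fin fg.
split => //; apply: fine_cvg; rewrite fineK; last exact: integrable_fin_num.
exact: i2.
Qed.

Lemma integrable_mul_bounded (f q : T -> R) (B : R) :
  measurable D -> mu.-integrable D (EFin \o f) -> measurable_fun D q ->
  (forall x, D x -> `|q x| <= B) ->
  mu.-integrable D (EFin \o (fun x => f x * q x)).
Proof.
move=> mD intf mq qB.
have -> : EFin \o (fun x => f x * q x) = ((EFin \o f) \* (EFin \o q))%E by [].
apply: integrableMl => //; exists B; split; first exact: num_real.
by move=> x Bx y Dy /=; rewrite (le_trans (qB _ Dy))// ltW.
Qed.

Lemma integrable_EFinD (f g : T -> R) : measurable D ->
  mu.-integrable D (EFin \o f) -> mu.-integrable D (EFin \o g) ->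
  mu.-integrable D (EFin \o (fun x => f x + g x)).
Proof. by move=> mD fi gi; exact: (integrableD mD fi gi). Qed.

Lemma integrable_EFinZ (a : R) (f : T -> R) : measurable D ->
  mu.-integrable D (EFin \o f) -> mu.-integrable D (EFin \o (fun x => a * f x)).
Proof. by move=> mD fi; exact: (integrableZl mD a fi). Qed.

Lemma integrable_EFin_sum (I : Type) (s : seq I) (F : I -> T -> R) :
  measurable D -> (forall i, mu.-integrable D (EFin \o F i)) ->
  mu.-integrable D (EFin \o (fun x => \sum_(i <- s) F i x)).
Proof.
move=> mD iF; elim: s => [|i s IH].
  by under [X in _ \o X]eq_fun do rewrite big_nil; exact: integrable0.
under [X in _ \o X]eq_fun do rewrite big_cons.
exact: integrable_EFinD.
Qed.

Lemma Rintegral_sum (I : Type) (s : seq I) (F : I -> T -> R) :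
  measurable D -> (forall i, mu.-integrable D (EFin \o F i)) ->
  \int[mu]_(x in D) (\sum_(i <- s) F i x) = \sum_(i <- s) \int[mu]_(x in D) F i x.
Proof.
move=> mD iF; elim: s => [|i s IH].
  by under eq_Rintegral do rewrite big_nil; rewrite Rintegral_cst// mul0r big_nil.
under eq_Rintegral do rewrite big_cons.
by rewrite RintegralD ?IH ?big_cons//; exact: integrable_EFin_sum.
Qed.

End Rintegral_complements.

(** * Polynomial approximation of the sign function *)

Section smoothstep.
Context {R : realType}.

(** The cubic Hermite step on [-1, 1]: it fixes -1, 0 and 1, with zero derivative at -1 and 1 and
    derivative 3/2 at 0, so iteration drives every nonzero point of [-1, 1] to its sign. *)
Definition smoothstep (x : R) : R := (3 * x - x ^+ 3) / 2.

Lemma smoothstep_gt0 (x : R) : 0 < x <= 1 ->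
  [/\ x <= smoothstep x, smoothstep x <= 1 &
      1 - smoothstep x <= (1 - x) * (1 - x / 2)].
Proof.
move=> /andP[x0 x1]; rewrite /smoothstep.
(* These products are twice [smoothstep x - x], twice [1 - smoothstep x], and twice the slack in the
   last inequality. *)
have h1 : 0 <= x * (1 - x) * (1 + x) by rewrite !mulr_ge0//; lra.
have h2 : 0 <= (1 - x) ^+ 2 * (2 + x) by rewrite mulr_ge0 ?sqr_ge0//; lra.
have h3 : 0 <= (1 - x) * x ^+ 2 by rewrite mulr_ge0 ?sqr_ge0//; lra.
by split; lra.
Qed.

Lemma iter_smoothstepN k (x : R) :
  iter k smoothstep (- x) = - iter k smoothstep x.
Proof.
by elim: k => //= k ->; rewrite /smoothstep; ring.
Qed.

(** The iterates never fall below x, so each contraction factor [1 - y / 2] of the distance to 1 is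
    at most [1 - x / 2], and the decay is geometric. *)
Lemma iter_smoothstep_gt0 k (x : R) : 0 < x <= 1 ->
  x <= iter k smoothstep x <= 1 /\
  1 - iter k smoothstep x <= (1 - x / 2) ^+ k.
Proof.
move=> x01; have /andP[x0 x1] := x01.
elim: k => [|k [/andP[IH1 IH2] IH3]]; first by rewrite expr0 lexx /=; split => //; lra.
have := @smoothstep_gt0 (iter k smoothstep x); rewrite IH2 andbT.
move=> /(_ (lt_le_trans x0 IH1))[h1 h2 h3]; rewrite iterS h2 andbT.
split; first exact: le_trans h1.
rewrite exprSr (le_trans h3)// ler_pM//; lra.
Qed.

Lemma iter_smoothstep_le1 k (x : R) : `|x| <= 1 -> `|iter k smoothstep x| <= 1.
Proof.
have pos y : 0 < y -> y <= 1 -> `|iter k smoothstep y| <= 1.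
  move=> y0 y1; have [|/andP[h1 h2] _] := @iter_smoothstep_gt0 k y; first by rewrite y0.
  by rewrite ger0_norm// (le_trans (ltW y0)).
rewrite ler_norml => /andP[x1 x2]; have [x0|x0|->] := ltgtP x 0; last 1 first.
- suff -> : iter k smoothstep 0 = 0 by rewrite normr0.
  by elim: k {pos} => [|k IH]; rewrite ?iterS ?IH /smoothstep /=; [|ring].
- by rewrite -normrN -iter_smoothstepN pos; lra.
- exact: pos.
Qed.

Lemma cvg_iter_smoothstep (x : R) : `|x| <= 1 ->
  iter k smoothstep x @[k --> \oo] --> Num.sg x.
Proof.
have pos (y : R) : 0 < y -> y <= 1 -> iter k smoothstep y @[k --> \oo] --> (1:R).
  move=> y0 y1; apply: (@squeeze_cvgr _ _ _ _
      (fun k => 1 - (1 - y / 2) ^+ k) (cst 1)).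
  - near=> k; have [|/andP[h1 h2] h3] := @iter_smoothstep_gt0 k y.
      by rewrite y0.
    by rewrite h2 andbT; lra.
  - rewrite -[X in _ --> X]subr0; apply: cvgB; first exact: cvg_cst.
    by apply: cvg_expr; rewrite ger0_norm; lra.
  - exact: cvg_cst.
rewrite ler_norml => /andP[x1 x2]; have [x0|x0|->] := ltgtP x 0.
- rewrite ltr0_sg//.
  rewrite (_ : (fun k => _) = fun k => - iter k smoothstep (- x)); last first.
    by apply/funext => k; rewrite iter_smoothstepN opprK.
  by apply: cvgN; apply: pos; rewrite ?oppr_gt0// lerNl.
- by rewrite gtr0_sg//; exact: pos.
- rewrite sgr0; suff -> : (fun k => iter k smoothstep 0) = cst 0 by exact: cvg_cst.
  by apply/funext; elim => [|k IH]; rewrite ?iterS ?IH /smoothstep /=; [|ring].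
Unshelve. all: by end_near. Qed.

End smoothstep.

(** * The algebra of multipliers preserving orthogonality to cosines *)

Section trigonometric_multipliers.
Context d (T : measurableType d) (R : realType) (mu : {measure set T -> \bar R}).
Context (n : nat) (Y : 'I_n -> T -> R).
Hypothesis mY : forall j, measurable_fun setT (Y j).

Definition wave (t : 'I_n -> R) (b : R) (w : T) : R :=
  cos (\sum_(j < n) t j * Y j w + b).

Definition wave_null (V : T -> R) :=
  mu.-integrable setT (EFin \o V) /\
  forall t b, \int[mu]_w (V w * wave t b w) = 0.

(** Stability is required for every V in [wave_null], not for one fixed V, so that a product of
    multipliers acts by composition. *)
Definition multiplier (q : T -> R) :=
  [/\ measurable_fun setT q, exists B : R, forall w, `|q w| <= B &
      forall V, wave_null V -> wave_null (fun w => V w * q w)].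

Lemma measurable_lincomb (t : 'I_n -> R) :
  measurable_fun setT (fun w => \sum_(j < n) t j * Y j w).
Proof.
by apply: measurable_sum => j; apply: measurable_funM => //; exact: mY.
Qed.

Lemma measurable_wave t b : measurable_fun setT (wave t b).
Proof.
apply: measurableT_comp.
  by apply: continuous_measurable_fun; exact: continuous_cos.
by apply: measurable_funD => //; exact: measurable_lincomb.
Qed.

Lemma wave_le1 t b w : `|wave t b w| <= 1.
Proof. exact: cos_max. Qed.

Lemma integrable_mul_wave V t b : mu.-integrable setT (EFin \o V) ->
  mu.-integrable setT (EFin \o (fun w => V w * wave t b w)).
Proof.
move=> iV; apply: (integrable_mul_bounded _ iV (measurable_wave t b)) => //.
by move=> w _; exact: wave_le1.
Qed.

Lemma multiplier_cst c : multiplier (cst c).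
Proof.
split; [exact: measurable_cst|by exists (`|c|)|] => V [iV V0]; split.
  exact: (@integrable_mul_bounded _ _ _ mu setT V (cst c) (`|c|)).
move=> t b; under eq_Rintegral do rewrite mulrAC mulrC.
by rewrite RintegralZl// ?V0 ?mulr0//; exact: integrable_mul_wave.
Qed.

Lemma multiplierD q1 q2 : multiplier q1 -> multiplier q2 ->
  multiplier (fun w => q1 w + q2 w).
Proof.
move=> [m1 [B1 b1] h1] [m2 [B2 b2] h2]; split; first exact: measurable_funD.
  by exists (B1 + B2) => w; rewrite (le_trans (ler_normD _ _))// lerD.
move=> V HV; have [i1 z1] := h1 _ HV; have [i2 z2] := h2 _ HV; split.
  by under [X in _ \o X]eq_fun do rewrite mulrDr; exact: integrable_EFinD.
move=> t b; under eq_Rintegral do rewrite mulrDr mulrDl.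
by rewrite RintegralD ?z1 ?z2 ?addr0//; exact: integrable_mul_wave.
Qed.

Lemma multiplierM q1 q2 : multiplier q1 -> multiplier q2 ->
  multiplier (fun w => q1 w * q2 w).
Proof.
move=> [m1 [B1 b1] h1] [m2 [B2 b2] h2]; split; first exact: measurable_funM.
  by exists (B1 * B2) => w; rewrite normrM ler_pM.
by move=> V /h1/h2; under eq_fun do rewrite -mulrA.
Qed.

(** Waves being bounded by 1, the uniform bound B makes [|V| * B] a dominating function. *)
Lemma multiplier_lim (q_ : (T -> R)^nat) (q : T -> R) (B : R) :
  (forall k, multiplier (q_ k)) -> (forall k w, `|q_ k w| <= B) ->
  (forall w, q_ k w @[k --> \oo] --> q w) -> multiplier q.
Proof.
move=> hq qB qq.
have mq : measurable_fun setT q.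
  by apply: (measurable_fun_cvgr (f_ := q_)) => // k; have [] := hq k.
have qB' w : `|q w| <= B.
  have /cvg_norm h := qq w; rewrite -(cvg_lim _ h)//.
  by apply: limr_le; [apply/cvg_ex; eexists; exact: h|exact: nearW].
split => //; first by exists B.
move=> V HV; have [iV V0] := HV.
split; first exact: (integrable_mul_bounded (B := B)).
move=> t b.
have [||||| _] := @Rintegral_dominated_cvg _ _ _ mu setT
  (fun k w => V w * q_ k w * wave t b w) (fun w => V w * q w * wave t b w)
  (fun w => `|V w| * B).
- exact: measurableT.
- move=> k; have [mqk _ _] := hq k.
  apply: measurable_funM; last exact: measurable_wave.
  by apply: measurable_funM => //; exact/measurable_EFinP/(measurable_int mu iV).
- by move=> w _; apply: cvgM; [apply: cvgM => //; exact: cvg_cst|exact: cvg_cst].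
- apply: (@integrable_mul_bounded _ _ _ mu setT (fun w => `|V w|) (cst B) (`|B|)) => //.
  exact: integrable_norm iV.
- move=> k w _; rewrite !normrM -[leRHS]mulr1 ler_pM ?wave_le1//.
  by rewrite ler_pM.
suff -> : (fun k => \int[mu]_w (V w * q_ k w * wave t b w)) = cst 0.
  by move=> /cvg_lim <-//; exact: lim_cst.
by apply/funext => k; have [_ _ /(_ V HV)[_]] := hq k.
Qed.

Lemma multiplier_wave t b : multiplier (wave t b).
Proof.
split; [exact: measurable_wave|by exists 1; exact: wave_le1|].
move=> V [iV V0]; split; first exact: integrable_mul_wave.
move=> t' b'.
(* 2 cos x cos x' = cos (x + x') + cos (x - x'): frequencies and phases add and subtract. *)
have E w : V w * wave t b w * wave t' b' w = 2^-1 *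
   (V w * wave (fun j => t j + t' j) (b + b') w +
    V w * wave (fun j => t j - t' j) (b - b') w).
  rewrite /wave.
  set x := \sum_(j < n) t j * _; set x' := \sum_(j < n) t' j * _.
  rewrite (_ : _ + (b + b') = (x + b) + (x' + b')); last first.
    rewrite addrACA -big_split/=; congr (_ + _).
    by apply: eq_bigr => j _; rewrite mulrDl.
  rewrite (_ : _ + (b - b') = (x + b) - (x' + b')); last first.
    rewrite opprD addrACA -sumrN -big_split/=; congr (_ + _).
    by apply: eq_bigr => j _; rewrite mulrBl.
  by rewrite cosB (cosD (x + b)); field.
under eq_Rintegral do rewrite E.
rewrite RintegralZl//.
  by rewrite RintegralD ?V0 ?addr0 ?mulr0//; exact: integrable_mul_wave.
by apply: integrable_EFinD => //; exact: integrable_mul_wave.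
Qed.

(* The iterates of the odd polynomial smoothstep converge to the sign on [-1, 1]. *)
Lemma multiplier_sgr q : multiplier q -> (forall w, `|q w| <= 1) ->
  multiplier (fun w => Num.sg (q w)).
Proof.
move=> hq q1; apply: (@multiplier_lim (fun k w => iter k smoothstep (q w)) _ 1).
- elim => //= k IH.
  rewrite (_ : (fun w => _) = (fun w => cst (3/2) w * iter k smoothstep (q w) +
    cst (- 2^-1) w * (iter k smoothstep (q w) * (iter k smoothstep (q w) *
       iter k smoothstep (q w))))); last first.
    by apply/funext => w; rewrite /smoothstep /=; field.
  apply: multiplierD; apply: multiplierM => //; try exact: multiplier_cst.
  by do 2 apply: multiplierM => //.
- by move=> k w; exact: iter_smoothstep_le1.
- by move=> w; exact: cvg_iter_smoothstep.
Qed.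

(* sgn (Y_j - a) is the limit of sgn (sin ((Y_j - a) / (k + 1))). *)
Lemma multiplier_sgr_coord j a : multiplier (fun w => Num.sg (Y j w - a)).
Proof.
pose s k (w : T) : R := Num.sg (sin ((Y j w - a) / k.+1%:R)).
apply: (@multiplier_lim s _ 1); rewrite /s.
- move=> k; apply: multiplier_sgr => [|w]; last exact: sin_max.
  pose t i : R := if i == j then k.+1%:R^-1 else 0.
  rewrite (_ : (fun w => _) = wave t (- (a / k.+1%:R) - pi / 2)).
    exact: multiplier_wave.
  apply/funext => w; rewrite /wave addrA cosBpihalf; congr sin.
  rewrite (bigD1 j)//= big1 ?addr0; last by move=> i /negbTE; rewrite /t => ->; rewrite mul0r.
  by rewrite /t eqxx mulrBl [in RHS]mulrC.
- by move=> k w; rewrite normr_sg lern1 leq_b1.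
(* The sign is discontinuous at 0, so convergence comes from eventual constancy: for large k the
   argument of the sine lies in ]-pi, pi[, where the sine has the sign of its argument. *)
- move=> w; apply: cvg_near_cst.
  have pos (y : R) : 0 < y -> \forall k \near \oo, 0 < y / k.+1%:R < pi.
    move=> y0; near=> k; rewrite divr_gt0//= ltr_pdivrMr//.
    rewrite -ltr_pdivrMl ?pi_gt0// -natr1 ltr_wpDr//.
    by near: k; exact: nbhs_infty_gtr.
  have [y0|y0|<-] := ltgtP (Y j w) a; last first.
  - by apply: nearW => k; rewrite subrr mul0r sin0 sgr0.
  - apply: filterS (pos (Y j w - a) _); last by rewrite subr_gt0.
    by move=> k /sin_gt0_pi/gtr0_sg ->; rewrite gtr0_sg// subr_gt0.
  - apply: filterS (pos (a - Y j w) _); last by rewrite subr_gt0.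
    move=> k /sin_gt0_pi h; rewrite -opprB mulNr sinN !sgrN (gtr0_sg h).
    by rewrite gtr0_sg// subr_gt0.
Unshelve. all: by end_near. Qed.

(** Closure under products gives finite intersections, hence a sigma-algebra and not merely a Dynkin
    system. *)
Lemma sigma_algebra_multiplier :
  sigma_algebra setT [set A | multiplier (\1_A : T -> R)].
Proof.
have compl A : multiplier (\1_A : T -> R) -> multiplier (\1_(~` A) : T -> R).
  move=> hA; rewrite (_ : \1_ _ = (fun w => cst 1 w + cst (-1) w * \1_A w)).
    by apply: multiplierD; [|apply: multiplierM] => //; exact: multiplier_cst.
  apply/funext => w /=; rewrite !indicE in_setC; case: (w \in A) => /=; ring.
split => /=.
- by rewrite indic0; exact: multiplier_cst.
- by move=> A; rewrite setTD; exact: compl.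
- move=> A hA.
  (* The indicator of the intersection of the complements is the pointwise limit of the finite
     products [q k]. *)
  rewrite -[X in \1_X]setCK setC_bigcup; apply/compl.
  pose q k w : R := \prod_(i < k) \1_(~` A i) w.
  have q01 k w : q k w = if `[< forall i, (i < k)%N -> ~ A i w >] then 1 else 0.
    case: asboolP => [h|].
      rewrite /q big1// => i _; rewrite indicE mem_set//; exact: h.
    move=> /existsNP[i /not_implyP[ik /contrapT Ai]].
    by rewrite /q (bigD1 (Ordinal ik))//= indicE memNset ?mul0r//=; exact.
  apply: (@multiplier_lim q _ 1).
  + elim => [|k IH].
      rewrite (_ : q 0%N = cst 1); first exact: multiplier_cst.
      by apply/funext => w; rewrite /q big_ord0.
    rewrite (_ : q k.+1 = fun w => q k w * \1_(~` A k) w).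
      by apply: multiplierM => //; exact: compl.
    by apply/funext => w; rewrite /q big_ord_recr.
  + by move=> k w; rewrite q01; case: ifP => _; rewrite ?normr1 ?normr0.
  + move=> w; apply: cvg_near_cst; rewrite indicE.
    have [Aw|] := pselect (forall i, ~ A i w).
      apply: nearW => k; rewrite q01 mem_set; last by move=> i _; exact: Aw.
      by rewrite asboolT.
    move=> /existsNP[i /contrapT Ai].
    near=> k; rewrite q01 memNset; last by move=> /(_ i I).
    rewrite asboolF// => /(_ i); apply => //.
    by near: k; exact: nbhs_infty_gt.
Unshelve. all: by end_near. Qed.

Lemma multiplier_indic A : g_sigma_preimage Y A -> multiplier (\1_A : T -> R).
Proof.
move=> YA.
suff : g_sigma_preimage Y `<=` [set A | multiplier (\1_A : T -> R)] by exact.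
apply: smallest_sub; first exact: sigma_algebra_multiplier.
move=> {YA}A; rewrite -bigcup_seq => -[j _ [B mB <-]]; rewrite setTI /=.
have [s0 sC sU] := sigma_algebra_multiplier.
suff : @measurable _ (measurableTypeR R) `<=` [set B | multiplier (\1_(Y j @^-1` B) : T -> R)] by exact.
rewrite (RGenOInfty.measurableE R); apply: smallest_sub.
  split => /=.
  - by rewrite preimage_set0.
  - by move=> C; rewrite setTD preimage_setC -setTD; exact: sC.
  - by move=> F hF; rewrite preimage_bigcup; exact: sU.
move=> _ [a ->] /=.
(* For a sign s, [(s + s * s) / 2] is 1 if s = 1, and 0 if s is 0 or -1. *)
rewrite (_ : \1_ _ = fun w => cst (2^-1) w *
  (Num.sg (Y j w - a) + Num.sg (Y j w - a) * Num.sg (Y j w - a))).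
  apply: multiplierM; first exact: multiplier_cst.
  by apply: multiplierD; [|apply: multiplierM]; exact: multiplier_sgr_coord.
apply/funext => w; rewrite indicE /=.
have -> : (w \in Y j @^-1` `]a, +oo[%classic) = (a < Y j w).
  by apply/idP/idP; rewrite inE /= in_itv/= andbT.
have [h|h|h] := ltgtP a (Y j w).
- by rewrite gtr0_sg ?subr_gt0//=; field.
- by rewrite ltr0_sg ?subr_lt0//=; ring.
- by rewrite h subrr sgr0 /=; ring.
Qed.

Lemma wave_null_integral_eq0 V A : wave_null V -> g_sigma_preimage Y A ->
  \int[mu]_w (V w * \1_A w) = 0.
Proof.
(* Zero frequency and zero phase give the constant wave 1. *)
move=> HV /multiplier_indic[_ _ /(_ V HV)[_ /(_ (fun=> 0) 0) <-]].
apply: eq_Rintegral => w _; rewrite /wave big1 ?addr0 ?cos0 ?mulr1// => j _.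
by rewrite mul0r.
Qed.

End trigonometric_multipliers.

(** * Gaussian laws *)

Section normal_affine.
Context {R : realType}.
Notation mu := (@lebesgue_measure R).

Definition affine (r c : R) : measurableTypeR R -> measurableTypeR R :=
  fun x => r * x + c.

Lemma measurable_affine r c : measurable_fun setT (affine r c).
Proof.
by apply: measurable_funD => //; apply: measurable_funM.
Qed.

(** By uniqueness of Lebesgue measure: the rescaled image measure takes the same values on the
    intervals ]a, b]. *)
Lemma lebesgue_measure_affine r c (A : set (measurableTypeR R)) : 0 < r ->
  measurable A -> mu A = (r%:E * mu (affine r c @^-1` A))%E.
Proof.
move=> r0 mA; have := measurable_affine r c => mF.
pose nu : {measure set (measurableTypeR R) -> \bar R} :=
  mscale (NngNum (ltW r0)) (pushforward mu (affine r c)).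
rewrite (@lebesgue_measure_unique R (nu mF))// => _ [[a b]] _ <-.
rewrite -[RHS]/(r%:E * mu (affine r c @^-1` `]a, b]%classic))%E.
have -> : affine r c @^-1` `]a, b]%classic = `](a - c) / r, (b - c) / r]%classic.
  apply/seteqP; split => x /=; rewrite !in_itv/= /affine;
    by rewrite ltr_pdivrMr// ler_pdivlMr// ltrBlDr lerBrDr mulrC.
rewrite !lebesgue_measure_itv/= !lte_fin ltr_pM2r ?invr_gt0// ltrD2r.
case: ifPn => _; last by rewrite mule0.
by rewrite !EFinN -!EFinB -EFinM; congr EFin; field; rewrite gt_eqF.
Qed.

(** The affine map sends the mean m1 to m2. Its slope carries absolute values because s1 and s2 may
    be negative: only their squares enter the densities. *)
Lemma normal_pdf_affine (m1 s1 m2 s2 x : R) : s1 != 0 -> s2 != 0 ->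
  normal_pdf m1 s1 x =
  (`|s2| / `|s1|) * normal_pdf m2 s2 (affine (`|s2| / `|s1|) (m2 - `|s2| / `|s1| * m1) x).
Proof.
move=> s10 s20; rewrite !normal_pdfE// mulrA; congr (_ * _).
  have sq (s : R) : Num.sqrt (s ^+ 2 * pi *+ 2) = `|s| * Num.sqrt (pi *+ 2).
    by rewrite -mulrnAr sqrtrM ?sqr_ge0// sqrtr_sqr.
  rewrite /normal_peak !sq.
  field; rewrite !normr_eq0 s10 s20 /= sqrtr_eq0 -ltNge.
  by rewrite mulrn_wgt0 ?pi_gt0.
rewrite /normal_fun /affine; congr expR.
rewrite -!(mulr_natr (_ ^+ 2) 2) -(real_normK (num_real s1)) -(real_normK (num_real s2)).
by field; rewrite !normr_eq0 s10 s20.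
Qed.

Lemma normal_prob_affine (m1 s1 m2 s2 : R) (B : set (measurableTypeR R)) :
  s1 != 0 -> s2 != 0 -> measurable B ->
  normal_prob m2 s2 B =
  normal_prob m1 s1 (affine (`|s2| / `|s1|) (m2 - `|s2| / `|s1| * m1) @^-1` B).
Proof.
move=> s10 s20 mB; set r := _ / _; set c := _ - _.
have r0 : 0 < r by rewrite divr_gt0 ?normr_gt0.
have mF := measurable_affine r c.
have mpdf : measurable_fun setT (fun x => (normal_pdf m2 s2 x)%:E).
  by apply/measurable_EFinP; exact: measurable_normal_pdf.
pose nu : {measure set (measurableTypeR R) -> \bar R} :=
  mscale (NngNum (ltW r0)) (pushforward mu (affine r c)).
rewrite /normal_prob.
transitivity (\int[nu mF]_(x in B) (normal_pdf m2 s2 x)%:E)%E.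
  by apply: eq_measure_integral => //= A mA _; exact: lebesgue_measure_affine.
rewrite ge0_integral_mscale//=; last 2 first.
- exact: measurable_funTS.
- by move=> x _; rewrite lee_fin normal_pdf_ge0.
rewrite ge0_integral_pushforward//=; last 2 first.
- exact: measurable_funTS.
- by move=> x _; rewrite lee_fin normal_pdf_ge0.
rewrite -ge0_integralZl//=; last 4 first.
- by rewrite -[X in measurable X]setTI; exact: mF.
- by apply: measurable_funTS; exact: measurableT_comp mpdf mF.
- by move=> x _; rewrite lee_fin normal_pdf_ge0.
- by rewrite lee_fin ltW.
by apply: eq_integral => x _; rewrite (normal_pdf_affine m1 m2 x s10 s20).
Qed.

End normal_affine.

Section gaussian_laws.
Context {R : realType} {dT : measure_display} {T : measurableType dT}.
Variable P : probability T R.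

Definition same_law (W1 W2 : T -> R) :=
  forall B : set (measurableTypeR R), measurable B -> P (W1 @^-1` B) = P (W2 @^-1` B).

Lemma same_law_Rintegral (W1 W2 : T -> R) (phi : R -> R) :
  measurable_fun setT W1 -> measurable_fun setT W2 -> measurable_fun setT phi ->
  same_law W1 W2 ->
  P.-integrable setT (EFin \o (phi \o W1)) ->
  P.-integrable setT (EFin \o (phi \o W2)) ->
  \int[P]_w phi (W1 w) = \int[P]_w phi (W2 w).
Proof.
move=> mW1 mW2 mphi W12 i1 i2.
have mEphi : measurable_fun [set: measurableTypeR R] (EFin \o phi).
  exact/measurable_EFinP.
congr fine.
transitivity (\int[pushforward P (W1 : T -> measurableTypeR R)]_y (EFin \o phi) y)%E.
  by rewrite integral_pushforward.
transitivity (\int[pushforward P (W2 : T -> measurableTypeR R)]_y (EFin \o phi) y)%E.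
  by apply: eq_measure_integral => B mB _; exact: W12.
by rewrite integral_pushforward.
Qed.

Lemma ae_eq0_of_sqr (W : T -> R) : measurable_fun setT W ->
  P.-integrable setT (EFin \o (fun w => W w ^+ 2)) ->
  \int[P]_w (W w ^+ 2) = 0 -> {ae P, forall w, W w = 0}.
Proof.
move=> mW iW W0.
have /(ae_eq_integral_abs P measurableT) h : measurable_fun setT (EFin \o (fun w => W w ^+ 2)).
  exact: measurable_int iW.
have : ae_eq P setT (EFin \o (fun w => W w ^+ 2)) (cst 0%E).
  apply/h; under eq_integral do rewrite /= ger0_norm ?sqr_ge0//.
  by rewrite -[LHS]fineK ?W0 ?(integrable_fin_num _ iW)//; congr EFin.
by apply: filterS => w /(_ I) /= [/eqP]; rewrite sqrf_eq0 => /eqP.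
Qed.

Lemma law_ae_eq0 (W : T -> R) (B : set (measurableTypeR R)) :
  measurable_fun setT W -> measurable B ->
  {ae P, forall w, W w = 0} -> P (W @^-1` B) = \d_(0 : R) B.
Proof.
move=> mW mB W0.
have mWB : measurable (W @^-1` B) by rewrite -[X in measurable X]setTI; exact: mW.
rewrite -(setIT (W @^-1` B)) -integral_indic//.
transitivity (\int[P]_w (\1_B (0:R))%:E)%E.
  apply: ae_eq_integral => //.
  - exact/measurable_EFinP.
  - by apply: filterS W0 => w + _ => W0; rewrite /= !indicE /= -[in RHS]W0.
by rewrite integral_cst// [X in (_ * X)%E](@probability_setT _ _ _ P) mule1 /dirac.
Qed.

(* An affine map carries the law of W1 to that of W2; equality of the first two
   moments forces it to be the identity, so no moment of a normal law is computed. *)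
Lemma gaussian_same_law (W1 W2 : T -> R) :
  measurable_fun setT W1 -> measurable_fun setT W2 ->
  P.-integrable setT (EFin \o W1) -> P.-integrable setT (EFin \o W2) ->
  P.-integrable setT (EFin \o (fun w => W1 w ^+ 2)) ->
  P.-integrable setT (EFin \o (fun w => W2 w ^+ 2)) ->
  gaussian_variable P W1 -> gaussian_variable P W2 ->
  \int[P]_w W1 w = 0 -> \int[P]_w W2 w = 0 ->
  \int[P]_w (W1 w ^+ 2) = \int[P]_w (W2 w ^+ 2) ->
  same_law W1 W2.
Proof.
move=> mW1 mW2 i1 i2 s1 s2 [m1 [sd1 g1]] [m2 [sd2 g2]] E1 E2 V12.
have Pcst (k : R) : \int[P]_w k = k.
  by rewrite Rintegral_cst// [X in fine X](@probability_setT _ _ _ P) mulr1.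
have [V0|V0] := eqVneq (\int[P]_w (W1 w ^+ 2)) 0.
  by move=> B mB; rewrite !law_ae_eq0//; apply: ae_eq0_of_sqr => //; rewrite -V12.
(* With s = 0 the law is a Dirac mass at m; mean zero forces m = 0, contradicting the nonzero second
   moment. *)
have nondeg (W : T -> R) (m s : R) : measurable_fun setT W ->
    P.-integrable setT (EFin \o W) ->
    P.-integrable setT (EFin \o (fun w => W w ^+ 2)) ->
    \int[P]_w W w = 0 -> \int[P]_w (W w ^+ 2) != 0 ->
    (forall B : set R, measurable B -> P (W @^-1` B) = gaussian_law m s B) ->
    s != 0.
  move=> mW iW sW EW VW g; apply: contra VW => s0.
  have Wm : same_law W (cst m).
    move=> B mB; rewrite g// /gaussian_law s0 preimage_cst diracE.
    case: (m \in B) => /=; last by rewrite measure0.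
    by rewrite [RHS]probability_setT.
  have m0 : m = 0.
    rewrite -EW -[LHS]Pcst; apply/esym/(same_law_Rintegral (phi := idfun)) => //.
    - exact: measurable_id.
    - exact: (@finite_measure_integrable_cst _ _ _ P setT m).
  rewrite (same_law_Rintegral (phi := fun x => x ^+ 2) _ _ _ Wm)//=.
  - by rewrite Pcst m0 expr0n.
  - exact: (@finite_measure_integrable_cst _ _ _ P setT (m ^+ 2)).
have sd10 : sd1 != 0 by exact: nondeg g1.
have sd20 : sd2 != 0 by rewrite V12 in V0; exact: nondeg g2.
pose r := `|sd2| / `|sd1|; pose c := m2 - r * m1.
have r0 : 0 < r by rewrite divr_gt0 ?normr_gt0.
have W2F : same_law W2 (affine r c \o W1).
  move=> B mB; rewrite g2// /gaussian_law (negbTE sd20) comp_preimage g1//; last first.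
    by rewrite -[X in measurable X]setTI; exact: measurable_affine.
  by rewrite /gaussian_law (negbTE sd10); exact: normal_prob_affine.
have mF : measurable_fun setT (affine r c \o W1 : T -> R).
  exact: measurableT_comp (measurable_affine r c) mW1.
have iF : P.-integrable setT (EFin \o (affine r c \o W1)).
  apply: integrable_EFinD => //; first exact: integrable_EFinZ.
  exact: finite_measure_integrable_cst.
have c0 : c = 0.
  rewrite -E2 (same_law_Rintegral (phi := idfun) _ _ _ W2F)//; last exact: measurable_id.
  rewrite /= /affine RintegralD//; last 2 first.
  - exact: integrable_EFinZ.
  - exact: finite_measure_integrable_cst.
  by rewrite RintegralZl// E1 mulr0 add0r Pcst.
have sqF : (fun w => (affine r c \o W1) w ^+ 2) = (fun w => r ^+ 2 * W1 w ^+ 2).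
  by apply/funext => w; rewrite /= /affine c0 addr0 exprMn.
have r1 : r = 1.
  have : \int[P]_w (W1 w ^+ 2) = r ^+ 2 * \int[P]_w (W1 w ^+ 2).
    transitivity (\int[P]_w ((affine r c \o W1) w ^+ 2)).
      rewrite V12; apply: (same_law_Rintegral (phi := fun x => x ^+ 2)) => //.
      rewrite (_ : _ \o _ = EFin \o (fun w => (affine r c \o W1) w ^+ 2))// sqF.
      exact: integrable_EFinZ.
    by rewrite -RintegralZl//; congr Rintegral; exact: sqF.
  rewrite -[LHS]mul1r => /(mulIf V0)/esym/eqP; rewrite sqrf_eq1 => /orP[/eqP//|/eqP r1].
  by move: r0; rewrite r1; lra.
move=> B mB; rewrite W2F//; congr (P (_ @^-1` B)).
by apply/funext => w; rewrite /= /affine r1 c0 mul1r addr0.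
Qed.

End gaussian_laws.

(** * Gaussian regression *)

Section sine_bounds.
Context {R : realType}.

(** This form of the mean value theorem serves both the bound [ler_norm_sin] and the limit
    [cvg_sin_scaled]. *)
Lemma sin_mean_value (x : R) : exists2 c, `|c| <= `|x| & sin x = x * cos c.
Proof.
wlog x0 : x / 0 <= x.
  move=> H; have [/H//|/ltW x0] := leP 0 x.
  have [|c cx sx] := H (- x); first by rewrite oppr_ge0.
  exists c; first by rewrite -(normrN x).
  by apply: oppr_inj; rewrite -sinN sx mulNr.
have [|c] := @MVT_segment R sin cos 0 x x0 (fun y _ => is_derive_sin y).
  by apply: continuous_subspaceT => y; exact: continuous_sin.
rewrite in_itv/= => /andP[c0 cx]; rewrite sin0 !subr0 mulrC => ->.
by exists c => //; rewrite !ger0_norm.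
Qed.

Lemma ler_norm_sin (x : R) : `|sin x| <= `|x|.
Proof.
have [c _ ->] := sin_mean_value x; rewrite normrM -[leRHS]mulr1.
by rewrite ler_pM// cos_max.
Qed.

(** The k-th term is z cos c with |c| at most |z| / (k + 1), so the cosine tends to 1. *)
Lemma cvg_sin_scaled (z : R) : k.+1%:R * sin (z / k.+1%:R) @[k --> \oo] --> z.
Proof.
have h k : {c | `|c| <= `|z| * k.+1%:R^-1 & k.+1%:R * sin (z / k.+1%:R) = z * cos c}.
  apply: cid2; have [c cz ->] := sin_mean_value (z / k.+1%:R); exists c.
    by rewrite normrM normfV [X in _ / X]ger0_norm in cz.
  by rewrite mulrA mulrCA divff ?mulr1.
rewrite (_ : (fun k => _) = (fun k => z * cos (s2val (h k)))); last first.
  by apply/funext => k; exact: (s2valP' (h k)).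
rewrite -[X in _ --> X]mulr1 -[X in _ * X]cos0.
apply: cvgM; first exact: cvg_cst.
apply: continuous_cvg; first exact: continuous_cos.
apply/cvgr0Pnorm_le => e e0; near=> k.
rewrite (le_trans (s2valP (h k)))// ler_pdivrMr// mulrC -ler_pdivrMr//.
by rewrite -natr1 ler_wpDr//; near: k; exact: nbhs_infty_ger.
Unshelve. all: by end_near. Qed.

End sine_bounds.

(** * Uncorrelated jointly Gaussian variables *)

Section uncorrelated_gaussian.
Context {R : realType} {dT : measure_display} {T : measurableType dT}.
Variable P : probability T R.

Definition square_integrable (X : T -> R) :=
  measurable_fun setT X /\ P.-integrable setT (EFin \o (fun w => X w ^+ 2)).

Lemma integrable_mul_sqr (X1 X2 : T -> R) :
  square_integrable X1 -> square_integrable X2 ->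
  P.-integrable setT (EFin \o (fun w => X1 w * X2 w)).
Proof.
move=> [mX1 iX1] [mX2 iX2].
apply: le_integrable (integrable_EFinD _ iX1 iX2) => //.
  by apply/measurable_EFinP; exact: measurable_funM.
move=> w _; rewrite lee_fin normrM [leRHS]ger0_norm ?addr_ge0 ?sqr_ge0//.
rewrite -(real_normK (num_real (X1 w))) -(real_normK (num_real (X2 w))).
have := sqr_ge0 (`|X1 w| - `|X2 w|); have := mulr_ge0 (normr_ge0 (X1 w)) (normr_ge0 (X2 w)).
by lra.
Qed.

Lemma square_integrable_cst c : square_integrable (cst c).
Proof.
split => //.
exact: (@finite_measure_integrable_cst _ _ _ P setT (c ^+ 2)).
Qed.

Lemma square_integrable_integrable (X : T -> R) : square_integrable X ->
  P.-integrable setT (EFin \o X).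
Proof.
move=> /integrable_mul_sqr/(_ (square_integrable_cst 1)).
by under [X in _ \o X]eq_fun do rewrite mulr1.
Qed.

Lemma square_integrableD (X1 X2 : T -> R) :
  square_integrable X1 -> square_integrable X2 ->
  square_integrable (fun w => X1 w + X2 w).
Proof.
move=> s1 s2; have [mX1 iX1] := s1; have [mX2 iX2] := s2.
split; first exact: measurable_funD.
rewrite (_ : (fun w => _) = (fun w => X1 w ^+ 2 + 2 * (X1 w * X2 w) + X2 w ^+ 2)).
  apply: integrable_EFinD => //; apply: integrable_EFinD => //.
  by apply: integrable_EFinZ => //; exact: integrable_mul_sqr.
by apply/funext => w; ring.
Qed.

Lemma square_integrableZ (a : R) (X : T -> R) :
  square_integrable X -> square_integrable (fun w => a * X w).
Proof.
move=> [mX iX]; split; first exact: measurable_funM.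
under [X in _ \o X]eq_fun do rewrite exprMn.
exact: integrable_EFinZ.
Qed.

Lemma square_integrable_sum (I : Type) (s : seq I) (X : I -> T -> R) :
  (forall i, square_integrable (X i)) ->
  square_integrable (fun w => \sum_(i <- s) X i w).
Proof.
move=> sX; elim: s => [|i s IH].
  under eq_fun do rewrite big_nil; exact: square_integrable_cst.
by under eq_fun do rewrite big_cons; exact: square_integrableD.
Qed.

Variables (n : nat) (Z : T -> R) (Y : 'I_n -> T -> R).
Hypotheses (sZ : square_integrable Z) (sY : forall j, square_integrable (Y j)).
Hypotheses (EZ : \int[P]_w Z w = 0) (EY : forall j, \int[P]_w Y j w = 0).
Hypothesis gauss : forall s (t : 'I_n -> R),
  gaussian_variable P (fun w => s * Z w + \sum_(j < n) t j * Y j w).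
Hypothesis ZY0 : forall j, \int[P]_w (Z w * Y j w) = 0.

Let Yt (t : 'I_n -> R) w := \sum_(j < n) t j * Y j w.

Let sYt t : square_integrable (Yt t).
Proof. by apply: square_integrable_sum => j; exact: square_integrableZ. Qed.

Let EYt t : \int[P]_w Yt t w = 0.
Proof.
rewrite Rintegral_sum//; last first.
  by move=> j; apply: integrable_EFinZ => //; exact: square_integrable_integrable.
by rewrite big1// => j _; rewrite RintegralZl// ?EY ?mulr0//;
  exact: square_integrable_integrable.
Qed.

Let ZYt t : \int[P]_w (Z w * Yt t w) = 0.
Proof.
under eq_Rintegral do rewrite mulr_sumr.
have i j : P.-integrable setT (EFin \o (fun w => Z w * Y j w)) by exact: integrable_mul_sqr.
under eq_Rintegral do under eq_bigr do rewrite mulrCA.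
rewrite Rintegral_sum//; last by move=> j; exact: integrable_EFinZ.
by rewrite big1// => j _; rewrite RintegralZl// ZY0 mulr0.
Qed.

(* Flipping the sign of Z does not change the law of s Z + t.Y, as both laws are
   centered Gaussian with the same variance. *)
Let flip s t : same_law P (fun w => s * Z w + Yt t w) (fun w => - s * Z w + Yt t w).
Proof.
have sW r : square_integrable (fun w => r * Z w + Yt t w).
  by apply: square_integrableD => //; exact: square_integrableZ.
have iZ := square_integrable_integrable sZ.
have iY := square_integrable_integrable (sYt t).
have E r : \int[P]_w (r * Z w + Yt t w) = 0.
  rewrite RintegralD//; last exact: integrable_EFinZ.
  by rewrite RintegralZl// EZ EYt mulr0 addr0.
(* The cross term vanishes by [ZYt], so the variance depends on r only through its square. *)
have V r : \int[P]_w ((r * Z w + Yt t w) ^+ 2) =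
    r ^+ 2 * \int[P]_w (Z w ^+ 2) + \int[P]_w (Yt t w ^+ 2).
  rewrite (_ : (fun w => _ ^+ 2) =
      (fun w => (r ^+ 2 * Z w ^+ 2 + (2 * r) * (Z w * Yt t w)) + Yt t w ^+ 2)); last first.
    by apply/funext => w; ring.
  have [mZ iZ2] := sZ; have [mYt iYt2] := sYt t.
  have iZY := integrable_mul_sqr sZ (sYt t).
  rewrite RintegralD//; last first.
    by apply: integrable_EFinD => //; exact: integrable_EFinZ.
  rewrite RintegralD//; [|exact: integrable_EFinZ..].
  by rewrite !RintegralZl// ZYt mulr0 addr0.
apply: gaussian_same_law.
- by have [] := sW s.
- by have [] := sW (- s).
- exact: square_integrable_integrable.
- exact: square_integrable_integrable.
- by have [] := sW s.
- by have [] := sW (- s).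
- exact: gauss.
- exact: gauss.
- exact: E.
- exact: E.
- by rewrite !V sqrrN.
Qed.

Let mYt t : measurable_fun setT (Yt t). Proof. by have [] := sYt t. Qed.

Let mZ : measurable_fun setT Z. Proof. by have [] := sZ. Qed.

Let integrable_bounded (X : T -> R) : measurable_fun setT X ->
  (forall w, `|X w| <= 1) -> P.-integrable setT (EFin \o X).
Proof.
move=> mX X1.
have := @integrable_mul_bounded _ _ _ P setT (cst 1) X 1 measurableT.
move=> /(_ (@finite_measure_integrable_cst _ _ _ P setT 1 measurableT) mX (fun w _ => X1 w)).
by under [X in _ \o X]eq_fun do rewrite mul1r.
Qed.

Let m_sin (X : T -> R) : measurable_fun setT X -> measurable_fun setT (fun w => sin (X w)).
Proof.
by move=> mX; apply: measurableT_comp mX; apply: continuous_measurable_fun;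
  exact: continuous_sin.
Qed.

Let sin_wave s t b : \int[P]_w (sin (s * Z w) * wave Y t b w) = 0.
Proof.
(* [phi] absorbs the phase, so that the same function is integrated against the two laws compared in
   [flip]. *)
pose phi (x : R) := sin (x + b).
have mphi : measurable_fun setT phi.
  apply: continuous_measurable_fun => x.
  apply: (@continuous_comp _ _ _ (fun x => x + b) sin); last exact: continuous_sin.
  by apply: continuousD; [exact: id|exact: cst_continuous].
have mW r : measurable_fun setT (fun w => r * Z w + Yt t w).
  by apply: measurable_funD => //; exact: measurable_funM.
have iW r : P.-integrable setT (EFin \o (phi \o (fun w => r * Z w + Yt t w))).
  apply: integrable_bounded; first exact: measurableT_comp.
  by move=> w; exact: sin_max.
have := same_law_Rintegral (mW s) (mW (- s)) mphi (flip s t) (iW s) (iW (- s)).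
move=> /eqP; rewrite -subr_eq0 -(RintegralB measurableT (iW s) (iW (- s))) => /eqP h.
rewrite (_ : (fun w => _) =
    (fun w => 2^-1 * (phi (s * Z w + Yt t w) - phi (- s * Z w + Yt t w)))); last first.
  apply/funext => w; rewrite /phi /wave mulNr -/(Yt t w).
  by rewrite -!addrA (sinD (s * Z w)) (sinD (- (s * Z w))) sinN cosN; field.
rewrite RintegralZl//; first by rewrite h mulr0.
by apply: (integrable_EFinD _ (iW s)) => //; exact: integrableN (iW (- s)).
Qed.

Lemma uncorrelated_wave_null : wave_null P Y Z.
Proof.
have iZ := square_integrable_integrable sZ.
have mY j : measurable_fun setT (Y j) by have [] := sY j.
split => // t b.
have mwave := measurable_wave mY t b.
have [||||| _] := @Rintegral_dominated_cvg _ _ _ P setT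
  (fun k w => (k.+1%:R * sin (Z w / k.+1%:R)) * wave Y t b w)
  (fun w => Z w * wave Y t b w) (fun w => `|Z w|).
- exact: measurableT.
- move=> k; apply: measurable_funM => //; apply: measurable_funM => //.
  by apply: m_sin; apply: measurable_funM.
- by move=> w _; apply: cvgM; [exact: cvg_sin_scaled|exact: cvg_cst].
- exact: integrable_norm iZ.
- move=> k w _; rewrite normrM -[leRHS]mulr1 ler_pM// ?wave_le1//.
  (* The factor k + 1 cancels in the bound |sin x| <= |x| at x = Z / (k + 1), which leaves the
     dominating function |Z|. *)
  rewrite normrM ger0_norm// -ler_pdivlMl// (le_trans (ler_norm_sin _))//.
  by rewrite normrM normfV (ger0_norm (ler0n _ _)) mulrC.
rewrite (_ : (fun k => _) = cst 0); first by move=> /cvg_lim <-//; exact: lim_cst.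
apply/funext => k; under eq_Rintegral do rewrite -mulrA.
rewrite RintegralZl//.
  by under eq_Rintegral do rewrite (mulrC (Z _)); rewrite sin_wave mulr0.
apply: (@integrable_mul_bounded _ _ _ P setT _ _ 1) => //.
  apply: integrable_bounded; last by move=> w; exact: sin_max.
  by apply: m_sin; exact: measurable_funM.
by move=> w _; exact: wave_le1.
Qed.

End uncorrelated_gaussian.

(** * Least squares and conditional expectation *)

Section gaussian_regression.
Context {R : realType} {dT : measure_display} {T : measurableType dT}.
Variable P : probability T R.
Context (n : nat) (X : T -> R) (Y : 'I_n -> T -> R).
Hypotheses (sX : square_integrable P X) (sY : forall j, square_integrable P (Y j)).

Let comb (u : 'I_n -> R) w := \sum_(j < n) u j * Y j w.

Let s_comb u : square_integrable P (comb u).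
Proof. by apply: square_integrable_sum => j; exact: square_integrableZ. Qed.

Let resid (u : 'I_n -> R) w := X w - comb u w.

Let s_resid u : square_integrable P (resid u).
Proof.
apply: square_integrableD => //; rewrite (_ : (fun w => - comb u w) = (fun w => -1 * comb u w)).
  exact: square_integrableZ.
by apply/funext => w; rewrite mulN1r.
Qed.

Lemma Rintegral_mul_lincomb (W : T -> R) (u : 'I_n -> R) : square_integrable P W ->
  \int[P]_w (W w * \sum_(j < n) u j * Y j w) = \sum_(j < n) u j * \int[P]_w (W w * Y j w).
Proof.
move=> sW; under eq_Rintegral do rewrite mulr_sumr.
have iWY j : P.-integrable setT (EFin \o (fun w => W w * Y j w)).
  exact: integrable_mul_sqr.
under eq_Rintegral do under eq_bigr do rewrite mulrCA.
rewrite Rintegral_sum//; last by move=> j; exact: integrable_EFinZ.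
by apply: eq_bigr => j _; rewrite RintegralZl.
Qed.

(** The Gram matrix may be singular, so the system is shown to be consistent: its right-hand side is
    in the row space of G as soon as it annihilates the columns of [cokermx G]. *)
Lemma normal_equations : exists u : 'I_n -> R, forall j,
  \int[P]_w ((X w - \sum_(i < n) u i * Y i w) * Y j w) = 0.
Proof.
pose G : 'M[R]_n := \matrix_(i, j) \int[P]_w (Y i w * Y j w).
pose k : 'rV[R]_n := \row_j \int[P]_w (X w * Y j w).
(* If G c = 0, then c.Y vanishes almost everywhere, whence k c = 0. *)
suff /submxP[u ku] : (k <= G)%MS.
  exists (fun i => u ord0 i) => j; have := congr1 (fun M : 'rV[R]_n => M ord0 j) ku.
  rewrite !mxE => kE.
  rewrite (_ : (fun w => _) = (fun w => X w * Y j w - Y j w * comb (u ord0) w)); last first.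
    by apply/funext => w; rewrite /comb; ring.
  rewrite RintegralB//; [|exact: integrable_mul_sqr..].
  rewrite kE Rintegral_mul_lincomb// -sumrB big1// => i _; rewrite mxE.
  by under eq_Rintegral do rewrite mulrC; rewrite subrr.
rewrite submxE; apply/eqP/rowP => l; rewrite !mxE.
pose c i := cokermx G i l.
have Gc i : \sum_(j < n) c j * \int[P]_w (Y i w * Y j w) = 0.
  have := congr1 (fun M : 'M[R]_n => M i l) (mulmx_coker G); rewrite !mxE => GC; rewrite -[RHS]GC.
  by apply: eq_bigr => j _; rewrite mxE mulrC.
have c0 : \int[P]_w (comb c w ^+ 2) = 0.
  rewrite (_ : (fun w => _) = (fun w => comb c w * comb c w)); last first.
    by apply/funext => w; rewrite expr2.
  rewrite Rintegral_mul_lincomb// big1// => i _.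
  under eq_Rintegral do rewrite mulrC.
  by rewrite Rintegral_mul_lincomb// Gc mulr0.
have [mc ic] := s_comb c; have cae := ae_eq0_of_sqr mc ic c0.
transitivity (\int[P]_w (X w * comb c w)).
  rewrite Rintegral_mul_lincomb//; apply: eq_bigr => j _.
  by rewrite mxE mulrC.
transitivity (\int[P]_w (0 : R)); last by rewrite Rintegral_cst// mul0r.
congr fine; apply: ae_eq_integral => //.
- exact: measurable_int (integrable_mul_sqr sX (s_comb c)).
- by apply: filterS cae => w cw _; rewrite /= cw mulr0.
Qed.

(** Only second moments appear on the right, to be matched term by term with inner products in the
    Hilbert space. *)
Lemma Rintegral_sqr_resid (v : 'I_n -> R) :
  \int[P]_w ((X w - \sum_(j < n) v j * Y j w) ^+ 2) =
  \int[P]_w (X w * X w) - 2 * \sum_(j < n) v j * \int[P]_w (X w * Y j w) +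
  \sum_(i < n) \sum_(j < n) v i * (v j * \int[P]_w (Y i w * Y j w)).
Proof.
rewrite (_ : (fun w => _ ^+ 2) = (fun w => (X w * X w + (- 2) * (X w * comb v w)) +
   comb v w * comb v w)); last first.
  by apply/funext => w; rewrite -/(comb v w); ring.
have iXX := integrable_mul_sqr sX sX; have iXv := integrable_mul_sqr sX (s_comb v).
have ivv := integrable_mul_sqr (s_comb v) (s_comb v).
rewrite RintegralD//; last first.
  by apply: integrable_EFinD => //; exact: integrable_EFinZ.
rewrite RintegralD//; last exact: integrable_EFinZ.
rewrite RintegralZl// Rintegral_mul_lincomb// mulNr; congr (_ + _).
rewrite Rintegral_mul_lincomb//; apply: eq_bigr => i _.
rewrite -mulr_sumr; under eq_Rintegral do rewrite mulrC.
by rewrite Rintegral_mul_lincomb.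
Qed.

(** Pythagoras: X - v.Y is the sum of X - u.Y and (u - v).Y, whose cross term vanishes by the normal
    equations. *)
Lemma normal_equations_min (u v : 'I_n -> R) :
  (forall j, \int[P]_w ((X w - \sum_(i < n) u i * Y i w) * Y j w) = 0) ->
  \int[P]_w ((X w - \sum_(j < n) u j * Y j w) ^+ 2) <=
  \int[P]_w ((X w - \sum_(j < n) v j * Y j w) ^+ 2).
Proof.
move=> u0; pose c j := u j - v j.
have [_ ires] := s_resid u; have [_ ic] := s_comb c.
rewrite (_ : (fun w => (_ - \sum_(j < n) v j * _) ^+ 2) =
  (fun w => (resid u w ^+ 2 + 2 * (resid u w * comb c w)) + comb c w ^+ 2)); last first.
  apply/funext => w.
  have -> : \sum_(j < n) v j * Y j w = comb u w - comb c w.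
    by rewrite -sumrB; apply: eq_bigr => j _; rewrite /c; ring.
  by rewrite /resid; ring.
have irc := integrable_mul_sqr (s_resid u) (s_comb c).
rewrite [leRHS]RintegralD//; last first.
  by apply: integrable_EFinD => //; exact: integrable_EFinZ.
rewrite RintegralD//; last exact: integrable_EFinZ.
rewrite RintegralZl// Rintegral_mul_lincomb// big1; last first.
  by move=> j _; rewrite u0 mulr0.
rewrite mulr0 addr0 lerDl; apply: Rintegral_ge0 => w _; exact: sqr_ge0.
Qed.

(** The difference Xhat - L is sigma(Y)-measurable with zero integral over every event of sigma(Y),
    in particular where it is positive and where it is negative; hence E|Xhat - L| = 0. *)
Lemma cond_expectation_uniq (Xhat L : T -> R) :
  (forall B : set R, measurable B -> g_sigma_preimage Y (L @^-1` B)) ->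
  P.-integrable setT (EFin \o L) ->
  (forall A, g_sigma_preimage Y A -> \int[P]_w ((X w - L w) * \1_A w) = 0) ->
  is_cond_expectation P Y X Xhat ->
  {ae P, forall w, Xhat w = L w}.
Proof.
move=> mL iL XL [mXhat iXhat EXhat].
have mY j : measurable_fun setT (Y j) by have [] := sY j.
have iX : P.-integrable setT (EFin \o X) by exact: square_integrable_integrable.
(* The carrier of T with the sigma-algebra generated by Y, so that sigma(Y)-measurability becomes
   [measurable_fun] on [S]. *)
pose S := g_sigma_algebraType
  (\big[setU/set0]_(i < n) preimage_set_system setT (Y i) (@measurable _ (measurableTypeR R))).
have subS A : g_sigma_preimage Y A -> measurable A.
  apply: smallest_sub; first exact: sigma_algebra_measurable.
  move=> {}A; rewrite -bigcup_seq => -[j _ [B mB <-]].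
  exact: mY.
pose D w := Xhat w - L w.
have mD : measurable_fun (setT : set S) (D : S -> R).
  by apply: measurable_funB => _ B mB; rewrite setTI; [exact: mXhat|exact: mL].
have iD : P.-integrable setT (EFin \o D).
  by apply: integrable_EFinD => //; exact: integrableN iL.
have D0 A : g_sigma_preimage Y A -> \int[P]_w (D w * \1_A w) = 0.
  move=> YA; have mA := subS _ YA.
  have mulA (V : T -> R) : P.-integrable setT (EFin \o V) ->
      P.-integrable setT (EFin \o (fun w => V w * \1_A w)).
    move=> iV; apply: (integrable_mul_bounded (B := 1) _ iV) => // w _.
    by rewrite indicE; case: (w \in A); rewrite ?normr1 ?normr0.
  have EA (V : T -> R) : \int[P]_w (V w * \1_A w) = fine (\int[P]_(w in A) (V w)%:E)%E.
    rewrite -/(Rintegral P A V) [RHS]Rintegral_mkcond; apply: eq_Rintegral => w _.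
    by rewrite patchE indicE; case: (w \in A); rewrite ?mulr1 ?mulr0.
  have := XL A YA; under eq_Rintegral do rewrite mulrBl.
  rewrite RintegralB//; [|exact: mulA..] => h.
  under eq_Rintegral do rewrite mulrBl.
  rewrite RintegralB//; [|exact: mulA..].
  by rewrite (EA Xhat) EXhat// -EA.
have pos : g_sigma_preimage Y [set w | 0 < D w].
  have := mD measurableT `]0, +oo[%classic (measurable_itv _); rewrite setTI.
  by congr (g_sigma_preimage Y _); apply/seteqP; split => w /=; rewrite in_itv/= andbT.
have neg : g_sigma_preimage Y [set w | D w < 0].
  have := mD measurableT `]-oo, 0[%classic (measurable_itv _); rewrite setTI.
  by congr (g_sigma_preimage Y _); apply/seteqP; split => w /=; rewrite in_itv/=.
have absD : \int[P]_w `|D w| = 0.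
  rewrite (_ : (fun w => _) = (fun w => D w * \1_[set w | 0 < D w] w -
      D w * \1_[set w | D w < 0] w)); last first.
    apply/funext => w; rewrite !indicE.
    have -> : (w \in [set w | 0 < D w]) = (0 < D w) by apply/idP/idP; rewrite inE.
    have -> : (w \in [set w | D w < 0]) = (D w < 0) by apply/idP/idP; rewrite inE.
    have [h|h|<-] := ltgtP 0 (D w); rewrite /=.
    - by rewrite gtr0_norm//; ring.
    - by rewrite ltr0_norm//; ring.
    - by rewrite normr0; ring.
  have mulA A : g_sigma_preimage Y A ->
      P.-integrable setT (EFin \o (fun w => D w * \1_A w)).
    move=> YA; have mA := subS _ YA.
    apply: (integrable_mul_bounded (B := 1) _ iD) => // w _.
    by rewrite indicE; case: (w \in A); rewrite ?normr1 ?normr0.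
  by rewrite RintegralB//; [|exact: mulA..]; rewrite !D0// subrr.
have /(ae_eq_integral_abs P measurableT)[+ _] : measurable_fun setT (EFin \o D).
  exact: measurable_int iD.
have aD : (\int[P]_w `|(EFin \o D) w|)%E = 0%E.
  rewrite -[LHS]fineK ?[fine _]absD//.
  exact: integrable_fin_num (integrable_norm iD).
move=> /(_ aD); apply: filterS => w /(_ I) [/eqP].
by rewrite subr_eq0 => /eqP.
Qed.

Hypotheses (EX : \int[P]_w X w = 0) (EY : forall j, \int[P]_w Y j w = 0).
Hypothesis gauss : forall s (t : 'I_n -> R),
  gaussian_variable P (fun w => s * X w + \sum_(j < n) t j * Y j w).

Lemma cond_expectation_gaussian (u : 'I_n -> R) (Xhat : T -> R) :
  (forall j, \int[P]_w ((X w - \sum_(i < n) u i * Y i w) * Y j w) = 0) ->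
  is_cond_expectation P Y X Xhat ->
  {ae P, forall w, Xhat w = \sum_(j < n) u j * Y j w}.
Proof.
move=> u0; have mY j : measurable_fun setT (Y j) by have [] := sY j.
have iX := square_integrable_integrable sX.
have iu := square_integrable_integrable (s_comb u).
apply: cond_expectation_uniq => //.
  move=> B mB.
  pose S := g_sigma_algebraType
    (\big[setU/set0]_(i < n) preimage_set_system setT (Y i) (@measurable _ (measurableTypeR R))).
  have mcomb : measurable_fun (setT : set S) (comb u : S -> R).
    apply: measurable_sum => j; apply: measurable_funM => // _ C mC; rewrite setTI.
    apply: sub_sigma_algebra; rewrite -bigcup_seq; exists j => /=.
      by rewrite mem_index_enum.
    by exists C => //; rewrite setTI.
  by have := mcomb measurableT B mB; rewrite setTI.
move=> A YA; apply: wave_null_integral_eq0 YA => //.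
apply: uncorrelated_wave_null => //.
- exact: s_resid.
- rewrite RintegralB// EX Rintegral_sum.
  + rewrite big1 ?subrr// => j _; rewrite RintegralZl// ?EY ?mulr0//.
    exact: square_integrable_integrable.
  + by [].
  + by move=> j; apply: integrable_EFinZ => //; exact: square_integrable_integrable.
- move=> s t.
  (* s (X - u.Y) + t.Y is again a combination of X and Y, with coefficients s and t - s u. *)
  rewrite (_ : (fun w => _) =
      (fun w => s * X w + \sum_(j < n) (t j - s * u j) * Y j w)); first exact: gauss.
  apply/funext => w.
  under [in RHS]eq_bigr do rewrite mulrBl -mulrA.
  by rewrite sumrB -mulr_sumr; ring.
Qed.

(** A version of the conditional expectation is only given as integrable; the finiteness of the
    error comes from its almost everywhere equality with u.Y. *)
Lemma cond_expectation_mse (u : 'I_n -> R) (Xhat : T -> R) :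
  (forall j, \int[P]_w ((X w - \sum_(i < n) u i * Y i w) * Y j w) = 0) ->
  is_cond_expectation P Y X Xhat ->
  ('E_P[fun w => ((X w - Xhat w) ^+ 2)%R])%E =
  (\int[P]_w ((X w - \sum_(j < n) u j * Y j w) ^+ 2))%:E.
Proof.
move=> u0 Xh; have [_ iXhat _] := Xh.
have [mres ires] := s_resid u.
rewrite unlock fineK; last exact: integrable_fin_num.
have mXhat : measurable_fun setT Xhat by exact/measurable_EFinP/(measurable_int P iXhat).
apply: ae_eq_integral => //.
- apply/measurable_EFinP/measurable_funX/measurable_funB => //.
  by have [] := sX.
- exact: measurable_int ires.
- apply: filterS (cond_expectation_gaussian u0 Xh) => w + _.
  by move=> /= ->.
Qed.

End gaussian_regression.

(** * Second moments of the process *)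

Section centered_families.
Context {R : realType} {dT : measure_display} {T : measurableType dT}.
Variable P : probability T R.

Lemma centered_covarianceE (X Y : T -> R) : ('E_P[X] = 0)%E -> ('E_P[Y] = 0)%E ->
  covariance P X Y = (\int[P]_w (X w * Y w)%:E)%E.
Proof.
move=> EX EY; rewrite covariance.unlock EX EY expectation.unlock.
by apply: eq_integral => w _ /=; rewrite !fctE /= !subr0.
Qed.

Variables (I : Type) (f : I -> {RV P >-> R}) (K : I -> I -> R).
Hypothesis fK : centered_with_covariance f K.

(** The second moment of [f i] is the real number [K i i], hence finite. *)
Lemma centered_square_integrable i : square_integrable P (f i).
Proof.
have [E0 cov] := fK; split; first exact: measurable_funP.
apply/integrableP; split.
  by apply/measurable_EFinP; apply: measurable_funX; exact: measurable_funP.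
have := cov i i; rewrite centered_covarianceE// => fi.
under eq_integral do rewrite /= ger0_norm ?sqr_ge0// expr2.
by rewrite fi ltry.
Qed.

Lemma centered_Rintegral i : \int[P]_w f i w = 0.
Proof. by have [/(_ i)] := fK; rewrite expectation.unlock /Rintegral => ->. Qed.

Lemma centered_RintegralM i j : \int[P]_w (f i w * f j w) = K i j.
Proof.
by have [E0 /(_ i j)] := fK; rewrite centered_covarianceE// /Rintegral => ->.
Qed.

Hypothesis gf : gaussian_process f.

Lemma gaussian_process_lincomb i n (j_ : 'I_n -> I) s (t : 'I_n -> R) :
  gaussian_variable P (fun w => s * f i w + \sum_(j < n) t j * f (j_ j) w).
Proof.
pose k (l : 'I_n.+1) := if unlift ord0 l is Some j then j_ j else i.
pose c (l : 'I_n.+1) := if unlift ord0 l is Some j then t j else s.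
rewrite (_ : (fun w => _) = fun w => \sum_(l < n.+1) c l * f (k l) w); first exact: gf.
apply/funext => w; rewrite big_ord_recl /c /k unlift_none; congr (_ + _).
by apply: eq_bigr => j _; rewrite liftK.
Qed.

End centered_families.

(** * Riemann sums on a compact set *)

Section uniform_continuity_on.
Context {R : realType} {U : pseudoMetricType R}.
Implicit Types (K : set U) (f g : U -> R).

Definition ucont_on K f := forall eta : R, 0 < eta -> exists2 delta : R, 0 < delta &
  forall x y, K x -> K y -> ball x delta y -> `|f x - f y| <= eta.

Lemma compact_ucont K f : compact K -> {within K, continuous f} -> ucont_on K f.
Proof.
move=> /compact_near_coveringP/near_covering_withinP cK cf eta eta0.
pose Q (delta : R) (x : U) :=
  0 < delta -> forall y, K y -> ball x delta y -> `|f x - f y| <= eta.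
have : \forall delta \near 0^'+, K `<=` Q delta.
  apply: cK => x Kx.
  move/subspace_continuousP : cf => /(_ x Kx)/cvgr_dist_le/(_ (eta / 2)).
  rewrite divr_gt0// => /(_ isT); rewrite near_withinE => /nbhs_ballP[r /= r0 xr].
  have r20 : 0 < r / 2 by rewrite divr_gt0.
  (* Half the radius leaves room for the triangle inequality: both y and z stay in the ball of
     radius r around x. *)
  exists (ball x (r / 2), [set delta | delta < r / 2]).
    by split => /=; [exact: nbhsx_ballx|exact: nbhs_right_lt].
  move=> -[y delta] /= [xy dr] Ky d0 z Kz yz.
  have xz : ball x r z.
    by rewrite (splitr r); apply: ball_triangle xy (le_ball (ltW dr) yz).
  have xy' : ball x r y by apply: le_ball xy; rewrite ler_pdivrMr// ler_peMr ?ler1n// ltW.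
  rewrite (splitr eta) (le_trans (ler_distD (f x) _ _))// lerD//.
    by rewrite distrC; exact: xr.
  exact: xr.
move=> H; near (0:R)^'+ => delta.
exists delta => // x y Kx Ky; apply: (_ : Q delta x) => //.
by move: x Kx {Ky}; near: delta.
Unshelve. all: by end_near. Qed.

Lemma ucont_cst K c : ucont_on K (cst c).
Proof. by move=> eta eta0; exists 1 => // x y _ _ _; rewrite subrr normr0 ltW. Qed.

Lemma ucontM K f g (B : R) : (forall x, K x -> `|f x| <= B) ->
  (forall x, K x -> `|g x| <= B) ->
  ucont_on K f -> ucont_on K g -> ucont_on K (fun x => f x * g x).
Proof.
move=> fB gB uf ug eta eta0.
(* B may vanish, or be negative when K is empty; this bound is always positive. *)
have B10 : 0 < `|B| + 1 by rewrite ltr_wpDl.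
have BB1 : B <= `|B| + 1 by rewrite (le_trans (ler_norm _))// lerDl.
have eta'0 : 0 < eta / (2 * (`|B| + 1)) by rewrite divr_gt0// mulr_gt0.
have [d1 d10 h1] := uf _ eta'0; have [d2 d20 h2] := ug _ eta'0.
exists (Num.min d1 d2) => [|x y Kx Ky xy]; first by rewrite lt_min d10.
have m1 : Num.min d1 d2 <= d1 by rewrite ge_min lexx.
have m2 : Num.min d1 d2 <= d2 by rewrite ge_min lexx orbT.
have {}h1 := h1 _ _ Kx Ky (le_ball m1 xy).
have {}h2 := h2 _ _ Kx Ky (le_ball m2 xy).
have -> : f x * g x - f y * g y = (f x - f y) * g x + f y * (g x - g y) by ring.
rewrite (le_trans (ler_normD _ _))// !normrM.
have -> : eta = eta / (2 * (`|B| + 1)) * (`|B| + 1) + (`|B| + 1) * (eta / (2 * (`|B| + 1))).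
  by field; rewrite gt_eqF.
by rewrite lerD// ler_pM// ?(le_trans (gB _ Kx))// (le_trans (fB _ Ky)).
Qed.

Lemma compact_net K (e : R) : compact K -> 0 < e ->
  exists2 s : seq U, (forall q, q \in s -> K q) &
    (forall x, K x -> exists2 q, q \in s & ball q e x).
Proof.
move=> /compact_near_coveringP cK e0.
(* Finite sequences in K directed by inclusion: the near-covering property then gives a single
   sequence, with all its terms in K, that serves every point of K. *)
pose F : set_system (seq U) := filter_from [set s : seq U | forall q, q \in s -> K q]
  (fun s : seq U => [set r : seq U | {subset s <= r} /\ forall q, q \in r -> K q]).
have FF : Filter F.
  apply: filter_from_filter; first by exists [::].
  move=> s t sK tK; exists (s ++ t) => [q|r [str rK]].
    by rewrite mem_cat => /orP[/sK|/tK].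
  by split; split => // q qs; apply: str; rewrite mem_cat qs ?orbT.
have [|s sK h] := cK _ F (fun (s : seq U) x => exists2 q, q \in s & ball q e x) FF; last first.
  by exists s => //; exact: (h s (conj (fun _ => id) sK)).
  move=> x Kx; exists (ball x e, [set r : seq U | x \in r]).
    split; first exact: nbhsx_ballx.
    exists [:: x] => [q|r [xr _]]; first by rewrite inE => /eqP ->.
    by apply: xr; rewrite inE.
  by move=> -[y r] /= [xy xr]; exists x.
Qed.

Lemma ucont_bounded K f : compact K -> ucont_on K f ->
  exists B, forall x, K x -> `|f x| <= B.
Proof.
move=> cK /(_ 1 ltr01)[delta d0 fd].
have [s sK Ks] := compact_net cK d0.
exists (\sum_(q <- s) `|f q| + 1) => x Kx.
have [q qs qx] := Ks _ Kx.
rewrite -(subrKC (f q) (f x)) (le_trans (ler_normD _ _))// lerD//.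
  rewrite (big_rem q)//= lerDl; exact: sumr_ge0.
by rewrite distrC; apply: fd => //; exact: sK.
Qed.

End uniform_continuity_on.

(** * Lebesgue measure of compact sets and quadrature rules *)

Section riemann_sums.
Context {R : realType} (d : nat).
Variable Omega : set 'rV[R]_d.
Hypothesis cO : compact Omega.
Notation mu := (@lebesgue_rV R d).

Lemma measurable_ball_rV (q : 'rV[R]_d) (e : R) : 0 < e -> measurable (ball q e).
Proof.
move=> e0; rewrite (_ : ball q e = \bigcap_(i in [set: 'I_d])
    (rV_coord i @^-1` (ball (q ord0 i) e))).
  apply: fin_bigcap_measurable => // i _; rewrite -[X in measurable X]setTI.
  apply: measurable_rV_coord => //.
  exact: measurable_ball.
apply/seteqP; split => [x [_ qx] i _|x qx]; first exact: qx.
by split => // i j; rewrite ord1; exact: qx.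
Qed.

Lemma lebesgue_ball_lty (q : 'rV[R]_d) (e : R) : 0 < e -> (mu (ball q e) < +oo)%E.
Proof.
move=> e0.
have box : measurable [set v : 'rV[R]_d |
    forall i, (q ord0 i - e <= v ord0 i <= q ord0 i + e)%R].
  rewrite (_ : [set _ | _] = \bigcap_(i in [set: 'I_d])
      (rV_coord i @^-1` [set` `[q ord0 i - e, q ord0 i + e]])).
    apply: fin_bigcap_measurable => // i _; rewrite -[X in measurable X]setTI.
    exact: measurable_rV_coord.
  apply/seteqP; split=> v /= h i.
    by move=> _; rewrite /rV_coord /= in_itv; exact: h.
  by move: (h i I); rewrite /rV_coord /= in_itv.
have : (mu (ball q e) <= mu [set v : 'rV[R]_d |
    forall i, (q ord0 i - e <= v ord0 i <= q ord0 i + e)%R])%E.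
  apply: le_measure; rewrite ?inE//; first exact: measurable_ball_rV.
  move=> x [_ qx] /= i; have := qx ord0 i.
  by rewrite /ball /= ltr_norml => /andP[h1 h2]; lra.
move=> /le_lt_trans; apply; rewrite (@lebesgue_rV_box R d (fun i => q ord0 i - e) (fun i => q ord0 i + e)).
  by rewrite ltry.
by move=> i; lra.
Qed.

Let inv_gt0 k : 0 < k.+1%:R^-1 :> R. Proof. by rewrite invr_gt0. Qed.

Let net k := compact_net cO (inv_gt0 k).

(** The sigma-algebra is generated by coordinates, so closed sets have to be built from balls, which
    are boxes: being closed, Omega is the intersection over k of the finite unions of balls of
    radius 1 / (k + 1) around its nets. *)
Lemma measurable_compact_rV : measurable Omega.
Proof.
pose s k := s2val (cid2 (net k)).
have sO k : forall q, q \in s k -> Omega q := s2valP (cid2 (net k)).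
have Os k : forall x, Omega x -> exists2 q, q \in s k & ball q k.+1%:R^-1 x :=
  s2valP' (cid2 (net k)).
have -> : Omega = \bigcap_k \bigcup_(q in [set` s k]) ball q (k.+1%:R^-1).
  apply/seteqP; split => [x Ox k _|x hx].
    by have [q qs qx] := Os k x Ox; exists q.
  have /closure_id -> : closed Omega by apply: compact_closed => //; exact: norm_hausdorff.
  move=> B /nbhs_ballP[e /= e0 xe].
  near \oo => k.
  have [q qs qx] := hx k I; exists q; split.
    exact: sO qs.
  apply: xe; apply: le_ball (ball_sym qx).
  rewrite invf_ple ?posrE// -natr1 ler_wpDr//.
  by near: k; exact: nbhs_infty_ger.
apply: bigcapT_measurable => k; apply: fin_bigcup_measurable.
  exact: finite_seq.
by move=> q _; exact: measurable_ball_rV.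
Unshelve. all: by end_near. Qed.

Lemma lebesgue_compact_lty : (mu Omega < +oo)%E.
Proof.
have [s sO Os] := net 0.
have h (r : seq 'rV[R]_d) : measurable (\big[setU/set0]_(q <- r) ball q 1%:R^-1) /\
    (mu (\big[setU/set0]_(q <- r) ball q 1%:R^-1) < +oo)%E.
  elim: r => [|q r [mr IH]]; first by rewrite big_nil measure0.
  have mq : measurable (ball q (1%:R^-1 : R)) by apply: measurable_ball_rV.
  rewrite big_cons; split; first exact: measurableU.
  rewrite (le_lt_trans (measureU2 _ _ _))// lte_add_pinfty//.
  exact: lebesgue_ball_lty.
apply: le_lt_trans (h s).2; apply: le_measure; rewrite ?inE.
- exact: measurable_compact_rV.
- exact: (h s).1.
- by move=> x /Os[q qs qx]; rewrite -bigcup_seq; exists q.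
Qed.

(* The cell of a point of Omega is that of the first element of the net which is
   close to it. *)
Lemma small_cells (e : R) : 0 < e -> exists m (q : 'I_m -> 'rV[R]_d) (D : 'I_m -> set 'rV[R]_d),
  [/\ forall i, Omega (q i), forall i, measurable (D i), forall i, D i `<=` Omega &
      forall x, Omega x -> exists i, ball (q i) e x /\ forall j, D j x <-> j = i].
Proof.
move=> e0; have [s sO Os] := compact_net cO e0.
exists (size s), (fun i => s`_i),
  (fun i => (Omega `&` ball s`_i e) `\` \bigcup_(j in `I_i) ball s`_j e).
split.
- by move=> i; apply: sO; exact: mem_nth.
- move=> i; apply: measurableD; first apply: measurableI.
  + exact: measurable_compact_rV.
  + exact: measurable_ball_rV.
  + by apply: bigcup_measurable => j _; exact: measurable_ball_rV.
- by move=> i x [[]].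
- move=> x Ox; have [q0 q0s q0x] := Os x Ox.
  have : exists i, `[< (i < size s)%N /\ ball s`_i e x >].
    exists (index q0 s); apply/asboolP; rewrite index_mem; split => //.
    by rewrite nth_index.
  move=> /ex_minnP[i /asboolP[im ix] imin].
  exists (Ordinal im); split => // j; split => [[[_ jx] nj]|->]; last first.
    split => // -[l /= li lx].
    have /imin : `[< (l < size s)%N /\ ball s`_l e x >].
      by apply/asboolP; split => //; exact: ltn_trans li im.
    by rewrite leqNgt => /negP; exact.
  apply: val_inj => /=; apply/eqP; rewrite eqn_leq imin ?andbT; last first.
    by apply/asboolP; split.
  by rewrite leqNgt; apply/negP => ij; apply: nj; exists i.
Qed.

Lemma Rintegral_step m (D : 'I_m -> set 'rV[R]_d) (c : 'I_m -> R) :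
  (forall i, measurable (D i)) -> (forall i, D i `<=` Omega) ->
  mu.-integrable Omega (EFin \o (fun x => \sum_(i < m) c i * \1_(D i) x)) /\
  \int[mu]_(x in Omega) (\sum_(i < m) c i * \1_(D i) x) =
  \sum_(i < m) fine (mu (D i)) * c i.
Proof.
move=> mD DO; have mO := measurable_compact_rV; have fO := lebesgue_compact_lty.
have iD i : mu.-integrable Omega (EFin \o (\1_(D i) : _ -> R)).
  apply: measurable_bounded_integrable => //.
  exists 1; split; first exact: num_real.
  move=> y y1 x _ /=; rewrite (le_trans _ (ltW y1))// indicE.
  by case: (x \in D i); rewrite ?normr1 ?normr0.
split; first by apply: integrable_EFin_sum => // i; exact: integrable_EFinZ.
rewrite Rintegral_sum//; last by move=> i; exact: integrable_EFinZ.
apply: eq_bigr => i _; rewrite RintegralZl// mulrC; congr (_ * _).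
by rewrite /Rintegral integral_indic// setIidl.
Qed.

(** Measurability comes from step functions: phi is the pointwise limit of the functions equal to
    [phi (q k i)] on the i-th cell of mesh 1 / (k + 1). *)
Lemma ucont_integrable phi : ucont_on Omega phi -> mu.-integrable Omega (EFin \o phi).
Proof.
move=> uphi; have mO := measurable_compact_rV; have fO := lebesgue_compact_lty.
have [B phiB] := ucont_bounded cO uphi.
apply: measurable_bounded_integrable => //; last first.
  exists B; split; first exact: num_real.
  by move=> y By x Ox /=; rewrite (le_trans _ (ltW By))// phiB.
pose cells k := small_cells (inv_gt0 k).
pose m k := projT1 (cid (cells k)).
pose q k := projT1 (cid (projT2 (cid (cells k)))).
pose D k := projT1 (cid (projT2 (cid (projT2 (cid (cells k)))))).
have cellP k := projT2 (cid (projT2 (cid (projT2 (cid (cells k)))))).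
apply: (measurable_fun_cvgr
  (f_ := fun k x => \sum_(i < m k) phi (q k i) * \1_(D k i) x)) => //.
  move=> k; have [_ mD DO _] := cellP k.
  have [i _] := Rintegral_step (phi \o q k) mD DO.
  by apply/measurable_EFinP; exact: measurable_int i.
move=> x Ox; apply/cvgrPdist_le => eta eta0.
have [delta d0 hd] := uphi _ eta0.
near=> k; have [qO _ _ /(_ x Ox)[i [ix Di]]] := cellP k.
rewrite (bigD1 i)//= big1 ?addr0; last first.
  by move=> j ji; rewrite indicE memNset ?mulr0// => /Di/eqP; exact/negP.
rewrite indicE mem_set ?mulr1; last exact/Di.
rewrite distrC; apply: hd => //; first exact: qO.
apply: le_ball ix; rewrite invf_ple ?posrE// -natr1 ler_wpDr//.
by near: k; exact: nbhs_infty_ger.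
Unshelve. all: by end_near. Qed.

(** Nodes and weights are fixed before phi, so one rule serves all integrands, and both variables of
    a double integral. *)
Definition riemann_rule (e : R) m (q : 'I_m -> 'rV[R]_d) (w : 'I_m -> R) :=
  [/\ forall i, Omega (q i), forall i, 0 <= w i, \sum_(i < m) w i = fine (mu Omega) &
    forall phi eta, ucont_on Omega phi ->
      (forall x y, Omega x -> Omega y -> ball x e y -> `|phi x - phi y| <= eta) ->
      `|\sum_(i < m) w i * phi (q i) - \int[mu]_(x in Omega) phi x| <=
      eta * fine (mu Omega)].

(** The Riemann sum is the integral of a step function within eta of phi everywhere on Omega. *)
Lemma riemann_rule_ex (e : R) : 0 < e ->
  exists m (q : 'I_m -> 'rV[R]_d) (w : 'I_m -> R), riemann_rule e q w.
Proof.
move=> e0; have [m [q [D [qO mD DO cellP]]]] := small_cells e0.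
have mO := measurable_compact_rV; have fO := lebesgue_compact_lty.
have cellE c x i : Omega x -> (forall j, D j x <-> j = i) ->
    \sum_(j < m) c j * \1_(D j) x = c i :> R.
  move=> Ox Di; rewrite (bigD1 i)//= big1 ?addr0; last first.
    by move=> j ji; rewrite indicE memNset ?mulr0// => /Di/eqP; exact/negP.
  by rewrite indicE mem_set ?mulr1//; exact/Di.
exists m, q, (fun i => fine (mu (D i))); split => //.
- by move=> i; exact: fine_ge0.
- have [_] := Rintegral_step (cst 1) mD DO.
  under [in RHS]eq_bigr do rewrite mulr1.
  move=> <-; rewrite -[RHS]mul1r -Rintegral_cst//; apply: eq_Rintegral => x.
  by rewrite inE => Ox; have [i [_ Di]] := cellP x Ox; rewrite (cellE (cst 1) x i).
- move=> phi eta uphi heta.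
  have iphi := ucont_integrable uphi.
  have [istep <-] := Rintegral_step (phi \o q) mD DO.
  rewrite -RintegralB//.
  have idiff : mu.-integrable Omega (EFin \o
      (fun x => \sum_(i < m) (phi \o q) i * \1_(D i) x - phi x)).
    by apply: integrable_EFinD => //; exact: integrableN iphi.
  rewrite (le_trans (le_normr_Rintegral mO idiff))// -Rintegral_cst//.
  apply: le_Rintegral => //.
  + exact: integrable_norm idiff.
  + exact: ucont_integrable (@ucont_cst _ _ Omega eta).
  + move=> x Ox; have [i [ix Di]] := cellP x Ox.
    by rewrite (cellE _ x i)//=; exact: heta.
Qed.

End riemann_sums.

(** * The integral operator and the reproducing kernel Hilbert space *)

Section rkhs_theory.
Context {R : realType} {X : Type} {k : X -> X -> R} (H : rkhs k).
Implicit Types f g h : X -> R.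

Notation S := (rkhs_set H).
Notation dot := (rkhs_dot H).

Lemma rkhs_setZ a f : S f -> S (a *: f).
Proof. by move=> Sf; rewrite -[a *: f]addr0; exact: rkhs_setZD Sf (rkhs_set0 H). Qed.

Lemma rkhs_setD f g : S f -> S g -> S (f + g).
Proof. by move=> Sf Sg; rewrite -[f]scale1r; exact: rkhs_setZD. Qed.

Lemma rkhs_setB f g : S f -> S g -> S (f - g).
Proof. by move=> Sf Sg; rewrite addrC -scaleN1r; exact: rkhs_setZD. Qed.

Lemma rkhs_set_sum m (f : 'I_m -> X -> R) (c : 'I_m -> R) :
  (forall i, S (f i)) -> S (\sum_(i < m) c i *: f i).
Proof.
move=> Sf; elim/big_ind : _ => [|g h|i _]; first exact: rkhs_set0.
  exact: rkhs_setD.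
exact: rkhs_setZ.
Qed.

Lemma rkhs_dotDl f g h : S f -> S g -> S h -> dot (f + g) h = dot f h + dot g h.
Proof. by move=> Sf Sg Sh; rewrite -{1}[f]scale1r rkhs_dotZD// mul1r. Qed.

Lemma rkhs_dot0l h : S h -> dot 0 h = 0.
Proof.
move=> Sh; have := rkhs_dotDl (rkhs_set0 H) (rkhs_set0 H) Sh.
by rewrite addr0 => /eqP; rewrite -subr_eq subrr eq_sym => /eqP.
Qed.

Lemma rkhs_dotZl a f h : S f -> S h -> dot (a *: f) h = a * dot f h.
Proof.
move=> Sf Sh; rewrite -[a *: f]addr0 rkhs_dotZD//; last exact: rkhs_set0.
by rewrite rkhs_dot0l// addr0.
Qed.

Lemma rkhs_dotBl f g h : S f -> S g -> S h -> dot (f - g) h = dot f h - dot g h.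
Proof.
by move=> Sf Sg Sh; rewrite addrC -scaleN1r rkhs_dotZD// mulN1r addrC.
Qed.

Lemma rkhs_dotBr f g h : S f -> S g -> S h -> dot h (f - g) = dot h f - dot h g.
Proof.
move=> Sf Sg Sh; rewrite rkhs_dotC//; last exact: rkhs_setB.
by rewrite rkhs_dotBl// !(rkhs_dotC Sh).
Qed.

Lemma rkhs_dot_suml m (f : 'I_m -> X -> R) (c : 'I_m -> R) h :
  (forall i, S (f i)) -> S h ->
  dot (\sum_(i < m) c i *: f i) h = \sum_(i < m) c i * dot (f i) h.
Proof.
move=> Sf Sh.
(* Linearity of [dot] holds on [S] only, so membership of the partial sums is carried through the
   induction. *)
suff [] : S (\sum_(i < m) c i *: f i) /\
  dot (\sum_(i < m) c i *: f i) h = \sum_(i < m) c i * dot (f i) h by [].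
elim/big_rec2 : _ => [|i x y _ [Sy IH]].
  by split; [exact: rkhs_set0|exact: rkhs_dot0l].
split; first by apply: rkhs_setD => //; exact: rkhs_setZ.
by rewrite rkhs_dotZD// IH.
Qed.

Lemma rkhs_dot_sumr m (f : 'I_m -> X -> R) (c : 'I_m -> R) h :
  (forall i, S (f i)) -> S h ->
  dot h (\sum_(i < m) c i *: f i) = \sum_(i < m) c i * dot h (f i).
Proof.
move=> Sf Sh; rewrite rkhs_dotC//; last exact: rkhs_set_sum.
by rewrite rkhs_dot_suml//; apply: eq_bigr => i _; rewrite (rkhs_dotC Sh).
Qed.

Lemma rkhs_dot_ge0 f : S f -> 0 <= dot f f.
Proof.
move=> Sf; have [->|f0] := pselect (f = 0); last exact/ltW/rkhs_dot_gt0.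
by rewrite rkhs_dot0l//; exact: rkhs_set0.
Qed.

Lemma rkhs_normE f : S f -> rkhs_norm H f ^+ 2 = dot f f.
Proof. by move=> Sf; rewrite sqr_sqrtr// rkhs_dot_ge0. Qed.

Lemma rkhs_cauchy_schwarz f g : S f -> S g ->
  `|dot f g| <= rkhs_norm H f * rkhs_norm H g.
Proof.
move=> Sf Sg.
have [->|g0] := pselect (g = 0).
  rewrite rkhs_dotC//; last exact: rkhs_set0.
  by rewrite rkhs_dot0l// normr0 mulr_ge0// sqrtr_ge0.
have gg0 := rkhs_dot_gt0 Sg g0.
rewrite -(@ler_pXn2r _ 2)//; last first.
  by rewrite nnegrE mulr_ge0// sqrtr_ge0.
rewrite exprMn !rkhs_normE// real_normK ?num_real//.
(* With a, b, c the products (f,f), (f,g), (g,g), the squared norm of c f - b g is c (a c - b ^ 2),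
   and c is positive. *)
have := rkhs_dot_ge0 (rkhs_setB (rkhs_setZ (dot g g) Sf) (rkhs_setZ (dot f g) Sg)).
have S1 := rkhs_setZ (dot g g) Sf; have S2 := rkhs_setZ (dot f g) Sg.
rewrite rkhs_dotBl//; last exact: rkhs_setB.
rewrite !rkhs_dotBr// !rkhs_dotZl//.
rewrite !(rkhs_dotC _ S1)// !(rkhs_dotC _ S2)// !rkhs_dotZl// (rkhs_dotC Sg Sf).
set a := dot f f; set b := dot f g; set c := dot g g => h.
have : 0 <= c * (a * c - b ^+ 2).
  by rewrite (le_trans h)// le_eqVlt; apply/orP; left; apply/eqP; ring.
by rewrite pmulr_rge0// subr_ge0.
Qed.

Lemma rkhs_cvg_dot (u : nat -> X -> R) f h : (forall n, S (u n)) -> S f -> S h ->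
  rkhs_norm H (u n - f) @[n --> \oo] --> 0 ->
  dot (u n) h @[n --> \oo] --> dot f h.
Proof.
move=> Su Sf Sh uf; apply/subr_cvg0.
have ub : rkhs_norm H (u n - f) * rkhs_norm H h @[n --> \oo] --> 0.
  by rewrite -[X in _ --> X](mul0r (rkhs_norm H h)); apply: cvgM => //; exact: cvg_cst.
apply/norm_cvg0P; apply: (squeeze_cvgr _ (cvg_cst _) ub).
apply: nearW => n; rewrite normr_ge0 /= -rkhs_dotBl//.
by apply: rkhs_cauchy_schwarz => //; exact: rkhs_setB.
Qed.

(* Norm convergence implies pointwise convergence, so the norm limit is t. *)
Lemma rkhs_set_cvg (u : nat -> X -> R) (t : X -> R) :
  (forall n, S (u n)) ->
  (forall e, 0 < e -> exists N, forall m n, (N <= m)%N -> (N <= n)%N ->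
     dot (u m - u n) (u m - u n) <= e) ->
  (forall y, u n y @[n --> \oo] --> t y) ->
  S t /\ rkhs_norm H (u n - t) @[n --> \oo] --> 0.
Proof.
move=> Su Cu ut.
have [|h Sh uh] := @rkhs_complete _ _ _ H u Su.
  move=> e e0; have [|N HN] := Cu ((e / 2) ^+ 2).
    by rewrite exprn_gt0// divr_gt0.
  exists N => m n Nm Nn.
  apply: (@le_lt_trans _ _ (e / 2)); last by rewrite ltr_pdivrMr// ltr_pMr// ltr1n.
  have -> : e / 2 = Num.sqrt ((e / 2) ^+ 2) by rewrite sqrtr_sqr ger0_norm// divr_ge0// ltW.
  by apply: ler_wsqrtr; exact: HN.
suff -> : t = h by [].
apply/funext => y.
have h1 : u n y @[n --> \oo] --> h y.
  have := rkhs_cvg_dot Su Sh (rkhs_kernel H y) uh.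
  rewrite rkhs_reproducing//; apply: cvg_trans; apply: near_eq_cvg.
  by apply: nearW => n; rewrite rkhs_reproducing.
by rewrite -(cvg_lim _ (ut y))// -(cvg_lim _ h1).
Qed.

End rkhs_theory.

(** * The operator T as a norm limit of kernel sums *)

Section integral_operator_rkhs.
Context {R : realType} (d : nat).
Variables (Omega : set 'rV[R]_d) (Psi : 'rV[R]_d -> 'rV[R]_d -> R).
Hypothesis cO : compact Omega.
Hypothesis cPsi : {within Omega `*` Omega, continuous (fun p => Psi p.1 p.2)}.
Variable H : rkhs (kernel_on (Omega := Omega) Psi).
Notation mu := (@lebesgue_rV R d).
Notation vol := (fine (mu Omega)).

Definition ucont2 (F : 'rV[R]_d -> 'rV[R]_d -> R) :=
  forall eta : R, 0 < eta -> exists2 delta : R, 0 < delta &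
  forall x x' y y', Omega x -> Omega x' -> Omega y -> Omega y' ->
    ball x delta x' -> ball y delta y' -> `|F x y - F x' y'| <= eta.

Lemma integrand_ucont2 (g g' : 'rV[R]_d -> R) :
  {within Omega, continuous g} -> {within Omega, continuous g'} ->
  ucont2 (fun x y => g x * g' y * Psi x y).
Proof.
move=> /(compact_ucont cO) ug /(compact_ucont cO) ug'.
have cOO : compact (Omega `*` Omega) by exact: compact_setX.
have uPsi := compact_ucont cOO cPsi.
have [Bg hg] := ucont_bounded cO ug; have [Bg' hg'] := ucont_bounded cO ug'.
have [BP hP] := ucont_bounded cOO uPsi.
have ug1 : ucont_on (Omega `*` Omega) (fun p => g p.1).
  move=> eta /ug[delta d0 hd]; exists delta => // x y [x1 _] [y1 _] [xy _].
  exact: hd.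
have ug2 : ucont_on (Omega `*` Omega) (fun p => g' p.2).
  move=> eta /ug'[delta d0 hd]; exists delta => // x y [_ x2] [_ y2] [_ xy].
  exact: hd.
have b12 (p : 'rV[R]_d * 'rV[R]_d) : (Omega `*` Omega) p -> `|g p.1 * g' p.2| <= `|Bg| * `|Bg'|.
  move=> [p1 p2]; rewrite normrM ler_pM//.
    by rewrite (le_trans (hg _ p1))// ler_norm.
  by rewrite (le_trans (hg' _ p2))// ler_norm.
have u12 : ucont_on (Omega `*` Omega) (fun p => g p.1 * g' p.2).
  apply: (@ucontM _ _ _ _ _ (`|Bg| + `|Bg'|)) => // p [p1 p2].
    by rewrite (le_trans (hg _ p1))// (le_trans (ler_norm _))// lerDl.
  by rewrite (le_trans (hg' _ p2))// (le_trans (ler_norm _))// lerDr.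
have : ucont_on (Omega `*` Omega) (fun p => g p.1 * g' p.2 * Psi p.1 p.2).
  apply: (@ucontM _ _ _ _ _ (`|Bg| * `|Bg'| + `|BP|)) => // p Op.
    by rewrite (le_trans (b12 _ Op))// lerDl.
  by rewrite (le_trans (hP _ Op))// (le_trans (ler_norm _))// lerDr mulr_ge0.
move=> u eta /u[delta d0 hd]; exists delta => // x x' y y' Ox Ox' Oy Oy' xx' yy'.
exact: (hd (x, y) (x', y')).
Qed.

Lemma ucont2_slice F x : ucont2 F -> Omega x -> ucont_on Omega (F x).
Proof.
move=> uF Ox eta /uF[delta d0 hd]; exists delta => // y y' Oy Oy' yy'.
by apply: hd => //; exact: ballxx.
Qed.

Lemma integrand_slice (g : 'rV[R]_d -> R) x : {within Omega, continuous g} ->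
  Omega x -> ucont_on Omega (fun y => g y * Psi x y).
Proof.
move=> cg Ox.
have cst1 : {within Omega, continuous (cst 1 : 'rV[R]_d -> R)}.
  by apply: continuous_subspaceT; exact: cst_continuous.
move=> eta /(ucont2_slice (integrand_ucont2 cst1 cg) Ox)[delta d0 hd].
exists delta => // y y' Oy Oy' yy'.
by have := hd _ _ Oy Oy' yy'; rewrite !mul1r.
Qed.

Lemma Rintegral_slice_dist F (delta eta : R) x x' : ucont2 F ->
  Omega x -> Omega x' -> 0 < delta ->
  (forall x x' y y', Omega x -> Omega x' -> Omega y -> Omega y' ->
    ball x delta x' -> ball y delta y' -> `|F x y - F x' y'| <= eta) ->
  ball x delta x' ->
  `|\int[mu]_(y in Omega) F x y - \int[mu]_(y in Omega) F x' y| <= eta * vol.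
Proof.
move=> uF Ox Ox' d0 hF xx'; have mO := measurable_compact_rV cO.
have i1 := ucont_integrable cO (ucont2_slice uF Ox).
have i2 := ucont_integrable cO (ucont2_slice uF Ox').
have i12 : mu.-integrable Omega (EFin \o (fun y => F x y - F x' y)).
  by apply: integrable_EFinD => //; exact: integrableN i2.
rewrite -RintegralB// (le_trans (le_normr_Rintegral mO i12))// -Rintegral_cst//.
apply: le_Rintegral => //.
- exact: integrable_norm i12.
- exact: ucont_integrable (@ucont_cst _ _ Omega eta).
- by move=> y Oy; apply: hF => //; exact: ballxx.
Qed.

Lemma ucont_Rintegral F : ucont2 F ->
  ucont_on Omega (fun x => \int[mu]_(y in Omega) F x y).
Proof.
move=> uF eta eta0; have v0 : 0 <= vol by exact: fine_ge0.
(* Omega may be a null set, whence vol + 1 in place of vol. *)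
have eta'0 : 0 < eta / (vol + 1) by rewrite divr_gt0// ltr_wpDl.
have [delta d0 hd] := uF _ eta'0.
exists delta => // x x' Ox Ox' xx'.
rewrite (le_trans (Rintegral_slice_dist uF Ox Ox' d0 hd xx'))//.
by rewrite mulrAC ler_pdivrMr ?ltr_wpDl// ler_pM2l// lerDl.
Qed.

Section riemann_nodes.
Variables (m : nat -> nat) (q : forall i, 'I_(m i) -> 'rV[R]_d) (w : forall i, 'I_(m i) -> R).
Hypothesis nodesP : forall i, riemann_rule Omega i.+1%:R^-1 (@q i) (@w i).

Let qO i j : Omega (@q i j). Proof. by have [h _ _ _] := nodesP i; exact: h. Qed.

Let w_ge0 i j : 0 <= @w i j. Proof. by have [_ h _ _] := nodesP i; exact: h. Qed.

Let sum_w i : \sum_(j < m i) @w i j = vol. Proof. by have [_ _ h _] := nodesP i. Qed.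

Let riemannP i phi eta : ucont_on Omega phi ->
  (forall x y, Omega x -> Omega y -> ball x i.+1%:R^-1 y -> `|phi x - phi y| <= eta) ->
  `|\sum_(j < m i) @w i j * phi (@q i j) - \int[mu]_(x in Omega) phi x| <= eta * vol.
Proof. by have [_ _ _ h] := nodesP i; exact: h. Qed.

Let node i j : Omega := SigSub (mem_set (@qO i j)).

Let mesh_le (delta : R) : 0 < delta ->
  exists N : nat, forall i, (N <= i)%N -> i.+1%:R^-1 <= delta.
Proof.
move=> d0; have [N _ HN] : \forall i \near \oo, i.+1%:R^-1 <= delta.
  near=> i; rewrite invf_ple ?posrE// -natr1 ler_wpDr//.
  by near: i; exact: nbhs_infty_ger.
by exists N => i Ni; exact: HN.
Unshelve. all: by end_near. Qed.

Lemma cvg_riemann phi : ucont_on Omega phi ->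
  \sum_(j < m i) @w i j * phi (@q i j) @[i --> \oo] --> \int[mu]_(x in Omega) phi x.
Proof.
move=> uphi; have v0 : 0 <= vol by exact: fine_ge0.
apply/cvgrPdist_le => e e0.
have e'0 : 0 < e / (vol + 1) by rewrite divr_gt0// ltr_wpDl.
have [delta d0 hd] := uphi _ e'0; have [N HN] := mesh_le d0.
exists N => // i /= Ni; rewrite distrC.
rewrite (le_trans (riemannP uphi _ (eta := e / (vol + 1))))//.
  by move=> x y Ox Oy xy; apply: hd => //; exact: (le_ball (HN _ Ni) xy).
by rewrite mulrAC ler_pdivrMr ?ltr_wpDl// ler_pM2l// lerDl.
Qed.

(** The two meshes vary independently because the Cauchy property involves inner products of Riemann
    sums of different ranks. *)
Lemma cvg_riemann2 F : ucont2 F -> forall e : R, 0 < e ->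
  exists N, forall a b, (N <= a)%N -> (N <= b)%N ->
  `|\sum_(i < m a) \sum_(j < m b) @w a i * @w b j * F (@q a i) (@q b j) -
    \int[mu]_(x in Omega) (\int[mu]_(y in Omega) F x y)| <= e.
Proof.
move=> uF e e0; have v0 : 0 <= vol by exact: fine_ge0.
(* The inner sums and the outer sum each contribute an error of at most eta vol ^ 2. *)
pose eta := e / (2 * (vol + 1) * (vol + 1)).
have eta0 : 0 < eta by rewrite divr_gt0// !mulr_gt0// ltr_wpDl.
have [delta d0 hd] := uF _ eta0; have [N HN] := mesh_le d0.
exists N => a b Na Nb.
set G := fun x => \int[mu]_(y in Omega) F x y.
have uG : ucont_on Omega G by exact: ucont_Rintegral.
have h1 : `|\sum_(i < m a) @w a i * G (@q a i) - \int[mu]_(x in Omega) G x| <= eta * vol * vol.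
  apply: riemannP => // x y Ox Oy xy; apply: (Rintegral_slice_dist uF _ _ d0 hd) => //.
  exact: (le_ball (HN _ Na) xy).
have h2 i : `|\sum_(j < m b) @w b j * F (@q a i) (@q b j) - G (@q a i)| <= eta * vol.
  apply: riemannP; first exact: ucont2_slice.
  move=> x y Ox Oy xy; apply: hd => //; first exact: ballxx.
  exact: (le_ball (HN _ Nb) xy).
rewrite -(subrKA (\sum_(i < m a) @w a i * G (@q a i))) (le_trans (ler_normD _ _))//.
apply: (@le_trans _ _ (eta * vol * vol + eta * vol * vol)).
  rewrite lerD// -sumrB (le_trans (ler_norm_sum _ _ _))//.
  apply: (@le_trans _ _ (\sum_(i < m a) @w a i * (eta * vol))).
    apply: ler_sum => i _.
    have -> : \sum_(j < m b) @w a i * @w b j * F (@q a i) (@q b j) - @w a i * G (@q a i) =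
        @w a i * (\sum_(j < m b) @w b j * F (@q a i) (@q b j) - G (@q a i)).
      by rewrite mulrBr mulr_sumr; under eq_bigr do rewrite -mulrA.
    by rewrite normrM ger0_norm// ler_pM.
  by rewrite -mulr_suml sum_w mulrC.
have vv : vol * vol <= (vol + 1) * (vol + 1) by rewrite ler_pM// lerDl.
rewrite -mulrA -mulr2n -mulr_natr.
apply: (@le_trans _ _ (eta * ((vol + 1) * (vol + 1)) * 2)).
  by rewrite ler_pM2r// ler_pM2l.
by rewrite le_eqVlt; apply/orP; left; apply/eqP; rewrite /eta; field; rewrite gt_eqF// ltr_wpDl.
Qed.

Let kernel_sum (g : 'rV[R]_d -> R) i : Omega -> R :=
  \sum_(j < m i) (@w i j * g (@q i j)) *: (kernel_on Psi)^~ (@node i j).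

Let kernel_sum_set g i : rkhs_set H (kernel_sum g i).
Proof. by apply: rkhs_set_sum => j; exact: rkhs_kernel. Qed.

Let kernel_sumE g i y :
  kernel_sum g i y = \sum_(j < m i) @w i j * (g (@q i j) * Psi (set_val y) (@q i j)).
Proof.
rewrite /kernel_sum fct_sumE; apply: eq_bigr => j _.
by rewrite [RHS]mulrA.
Qed.

Let dot_kernel_sum g i h : rkhs_set H h ->
  rkhs_dot H (kernel_sum g i) h = \sum_(j < m i) @w i j * g (@q i j) * h (@node i j).
Proof.
move=> Sh; rewrite rkhs_dot_suml//; last by move=> j; exact: rkhs_kernel.
apply: eq_bigr => j _; rewrite rkhs_dotC//; last exact: rkhs_kernel.
by rewrite rkhs_reproducing.
Qed.

Let dot_kernel_sum2 g g' a b : rkhs_dot H (kernel_sum g a) (kernel_sum g' b) =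
  \sum_(i < m a) \sum_(j < m b)
    @w a i * @w b j * (g (@q a i) * g' (@q b j) * Psi (@q a i) (@q b j)).
Proof.
rewrite dot_kernel_sum//; apply: eq_bigr => i _.
rewrite kernel_sumE mulr_sumr; apply: eq_bigr => j _ /=.
by ring.
Qed.

Let integral_op_cvg g : {within Omega, continuous g} ->
  rkhs_set H (integral_op Psi g) /\
  rkhs_norm H (kernel_sum g i - integral_op Psi g) @[i --> \oo] --> 0.
Proof.
move=> cg; have ug := compact_ucont cO cg.
apply: rkhs_set_cvg => // [e e0|y].
  (* The squared distance of two kernel sums is an alternating sum of four double Riemann sums, each
     within e / 4 of the same double integral, which cancels. *)
  have e40 : 0 < e / 4 by rewrite divr_gt0.
  have [N HN] := cvg_riemann2 (integrand_ucont2 cg cg) e40.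
  exists N => a b Na Nb.
  rewrite rkhs_dotBl//; last exact: rkhs_setB.
  rewrite !rkhs_dotBr// !dot_kernel_sum2.
  have := HN _ _ Na Na; have := HN _ _ Na Nb; have := HN _ _ Nb Na; have := HN _ _ Nb Nb.
  by rewrite !ler_norml => /andP[? ?] /andP[? ?] /andP[? ?] /andP[? ?]; lra.
under eq_fun do rewrite kernel_sumE.
apply: (@cvg_riemann (fun x' => g x' * Psi (set_val y) x')).
by apply: integrand_slice => //; exact: set_valP.
Qed.

Let set_integral_op g : {within Omega, continuous g} ->
  rkhs_set H (integral_op Psi g).
Proof. by move=> /integral_op_cvg[]. Qed.

(** Only Tg is approximated: the reproducing property evaluates Tg' at the nodes, which gives a
    Riemann sum in x of the inner integral defining K(g, g'). *)
Lemma rkhs_integral_op_nodes g g' :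
  {within Omega, continuous g} -> {within Omega, continuous g'} ->
  rkhs_set H (integral_op Psi g) /\
  rkhs_dot H (integral_op Psi g) (integral_op Psi g') = integral_covariance Omega Psi g g'.
Proof.
move=> cg cg'; split; first exact: set_integral_op.
have [Sg hg] := integral_op_cvg cg; have Sg' := set_integral_op cg'.
have h1 := rkhs_cvg_dot (kernel_sum_set g) Sg Sg' hg.
have uF := integrand_ucont2 cg cg'.
have h2 := cvg_riemann (ucont_Rintegral uF).
suff E : (fun i => rkhs_dot H (kernel_sum g i) (integral_op Psi g')) =
    (fun i => \sum_(j < m i) @w i j *
       \int[mu]_(y in Omega) (g (@q i j) * g' y * Psi (@q i j) y)).
  by rewrite E in h1; rewrite -(cvg_lim _ h1)// (cvg_lim _ h2).
apply/funext => i; rewrite dot_kernel_sum//; apply: eq_bigr => j _.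
rewrite -mulrA; congr (_ * _); rewrite /integral_op /=.
rewrite -RintegralZl//; last 2 first.
- exact: measurable_compact_rV.
- apply: ucont_integrable => //.
  exact: (integrand_slice cg' (@qO i j)).
by apply: eq_Rintegral => x _; rewrite mulrA.
Qed.

End riemann_nodes.

Lemma rkhs_integral_op g g' :
  {within Omega, continuous g} -> {within Omega, continuous g'} ->
  rkhs_set H (integral_op Psi g) /\
  rkhs_dot H (integral_op Psi g) (integral_op Psi g') = integral_covariance Omega Psi g g'.
Proof.
move=> cg cg'.
have rule i : exists t : {m : nat & (('I_m -> 'rV[R]_d) * ('I_m -> R))%type},
    riemann_rule Omega i.+1%:R^-1 (projT2 t).1 (projT2 t).2.
  have [|m [q [w h]]] := @riemann_rule_ex R d Omega cO i.+1%:R^-1; first by rewrite invr_gt0.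
  by exists (existT _ m (q, w)).
pose t i := projT1 (cid (rule i)).
exact: (@rkhs_integral_op_nodes (fun i => projT1 (t i)) (fun i => (projT2 (t i)).1)
  (fun i => (projT2 (t i)).2) (fun i => projT2 (cid (rule i)))).
Qed.

End integral_operator_rkhs.

Theorem theorem1 (R : realType) (d : nat) (Omega : set 'rV[R]_d)
    (V : set ('rV[R]_d -> R)) (Psi : 'rV[R]_d -> 'rV[R]_d -> R)
    (N_Psi : rkhs (kernel_on (Omega := Omega) Psi))
    (dT : measure_display) (T : measurableType dT) (P : probability T R)
    (f : V -> {RV P >-> R})
    (n : nat) (g_ : 'I_n -> V) (fhat : V -> T -> R) :
  compact Omega ->
  convex_set (Omega : set (convex_lmodType 'rV[R]_d)) ->
  (forall g, V g -> {within Omega, continuous g}) ->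
  {within Omega `*` Omega, continuous (fun p => Psi p.1 p.2)} ->
  symmetric_on Omega Psi ->
  posdef_on Omega Psi ->
  gaussian_process f ->
  centered_with_covariance f
    (fun g g' => integral_covariance Omega Psi (set_val g) (set_val g')) ->
  (forall g, is_cond_expectation P (fun j => f (g_ j)) (f g) (fhat g)) ->
  forall g : V,
  let residual (u : 'rV[R]_n) : Omega -> R :=
    integral_op Psi (set_val g) -
    \sum_(j < n) u ord0 j *: integral_op Psi (set_val (g_ j)) in
  (forall u, rkhs_set N_Psi (residual u)) /\
  is_min [set (rkhs_norm N_Psi (residual u) ^+ 2)%:E | u in [set: 'rV[R]_n]]
    ('E_P[fun w => ((f g w - fhat g w) ^+ 2)%R])%E.
Proof.
move=> cO _ cV cPsi _ _ gf fK fhatP g residual.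
have ST h : rkhs_set N_Psi (integral_op Psi (set_val (h : V))).
  by have [] := rkhs_integral_op cO cPsi N_Psi (cV _ (set_valP h)) (cV _ (set_valP h)).
have SS (u : 'rV[R]_n) :
    rkhs_set N_Psi (\sum_(j < n) u ord0 j *: integral_op Psi (set_val (g_ j))).
  by apply: rkhs_set_sum => j; exact: ST.
have Sres u : rkhs_set N_Psi (residual u) by apply: rkhs_setB.
split => //.
(* Both sides are K(h, h'): the functions Th and the variables f(h) have the same Gram matrices. *)
have dotT (h h' : V) : rkhs_dot N_Psi (integral_op Psi (set_val h))
    (integral_op Psi (set_val h')) = \int[P]_w (f h w * f h' w).
  rewrite (centered_RintegralM fK).
  by have [] := rkhs_integral_op cO cPsi N_Psi (cV _ (set_valP h)) (cV _ (set_valP h')).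
have sf := centered_square_integrable fK.
have normres u : rkhs_norm N_Psi (residual u) ^+ 2 =
    \int[P]_w ((f g w - \sum_(j < n) u ord0 j * f (g_ j) w) ^+ 2).
  rewrite rkhs_normE// (Rintegral_sqr_resid (sf g) (fun j => sf (g_ j))).
  rewrite rkhs_dotBl// !rkhs_dotBr// dotT (rkhs_dotC (SS u))//.
  rewrite (rkhs_dot_sumr _ _ (ST g)) ?(rkhs_dot_suml _ _ (SS u))//.
  have -> : \sum_(j < n) u ord0 j * rkhs_dot N_Psi (integral_op Psi (set_val g))
      (integral_op Psi (set_val (g_ j))) =
      \sum_(j < n) u ord0 j * \int[P]_w (f g w * f (g_ j) w).
    by apply: eq_bigr => j _; rewrite dotT.
  have -> : \sum_(i < n) u ord0 i * rkhs_dot N_Psi (integral_op Psi (set_val (g_ i)))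
      (\sum_(j < n) u ord0 j *: integral_op Psi (set_val (g_ j))) =
      \sum_(i < n) \sum_(j < n) u ord0 i * (u ord0 j * \int[P]_w (f (g_ i) w * f (g_ j) w)).
    apply: eq_bigr => i _; rewrite rkhs_dot_sumr// mulr_sumr.
    by apply: eq_bigr => j _; rewrite dotT.
  by ring.
(* The same solution gives the coefficients of the conditional expectation and the point where the
   minimum is attained. *)
have [u0 hu0] := normal_equations (sf g) (fun j => sf (g_ j)).
rewrite (cond_expectation_mse (sf g) (fun j => sf (g_ j)) (centered_Rintegral fK g)
  (fun j => centered_Rintegral fK (g_ j)) (gaussian_process_lincomb gf g g_) hu0 (fhatP g)).
split.
  exists (\row_j u0 j) => //; rewrite normres; congr EFin.
  by apply: eq_Rintegral => w _; under eq_bigr do rewrite mxE.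
move=> _ [u _ <-]; rewrite lee_fin normres.
exact: (normal_equations_min (sf g) (fun j => sf (g_ j)) (fun j => u ord0 j) hu0).
Qed.
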